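(* Let $\alpha\ge 0$, $1\le s\le\infty$, $1\le p\le\infty$, $\mu>1-1/s$, $\mu>0$ (with $1/\infty=0$). (1) For all $0<\delta<1$, $$\mathcal E_\delta(W^\mu_s,\Psi,C,\ell_p)\asymp\delta^{\frac{\mu+1/s-1}{\mu-1/p+1/s}}.$$ (2) For any fixed $0<a\le b$, for all $0<\delta<1$ and all integers $N\ge1$ with $a\,\delta^{-\frac1{\mu-1/p+1/s}}\le N\le b\,\delta^{-\frac1{\mu-1/p+1/s}}$, $$R_{N,\delta}(W^\mu_s,\Psi_N,C,\ell_p)\asymp\delta^{\frac{\mu+1/s-1}{\mu-1/p+1/s}}\asymp N^{-\mu-1/s+1}.$$ (3) These orders are attained by any method from $\mathcal S^\theta$ with $\theta>\mu+1/s-1$, $\theta>0$: for any array $\nu$ in $\mathcal S^\theta$ with constant $C(\nu)$ and any $0<a\le b$ there is a constant $c$ such that, for all $\delta,N$ as in (2), $$\sup_{f\in L_{2,w},\ \|f\|_{s,\mu}\le1}\ \sup_{f^\delta\in L_{2,w}:\ \|\mathbf f^\delta-\mathbf f\|_{\ell_p}\le\delta}\|(f-S_N^\nu f^\delta)\sqrt w\|_C\le c\,\delta^{\frac{\mu+1/s-1}{\mu-1/p+1/s}}.$$ All constants depend only on $\alpha,\mu,s$, in (2) also on $a,b$, and in (3) also on $\theta$, $C(\nu)$, $a,b$.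
   Context: Let $w(t)=t^\alpha e^{-t}$ on $(0,\infty)$, and let $L_{2,w}$ be the real Hilbert space of functions square-summable with weight $w$, with $\langle f,g\rangle=\int_0^\infty t^\alpha e^{-t}f(t)g(t)\,dt$. The Laguerre polynomials are $L_k^{(\alpha)}(t)=\sum_{m=0}^k\frac{\Gamma(k+\alpha+1)}{\Gamma(m+\alpha+1)(k-m)!}\frac{(-t)^m}{m!}$, and $\ell_k^{(\alpha)}=\left(\frac{k!}{\Gamma(k+\alpha+1)}\right)^{1/2}L_k^{(\alpha)}$, $k\in\mathbb N_0=\{0,1,2,\dots\}$. $C$ is the space of real-valued continuous functions on $(0,\infty)$, with $\|g\|_C=\sup_{t>0}|g(t)|\in[0,\infty]$. $\ell_p$ is the usual sequence space on $\mathbb N_0$. For $f\in L_{2,w}$, $\mathbf f=(\langle f,\ell_k^{(\alpha)}\rangle)_{k\in\mathbb N_0}\in\ell_2$. For $\mu>0$ and $\underline k=\max\{1,k\}$: $\|f\|_{s,\mu}^s=\sum_{k=0}^\infty\underline k^{s\mu}|\langle f,\ell_k^{(\alpha)}\rangle|^s$ for $1\le s<\infty$, $\|f\|_{\infty,\mu}=\sup_k\underline k^\mu|\langle f,\ell_k^{(\alpha)}\rangle|$. The function class is $W^\mu_s=\{f\in L_{2,w}:\|f\|_{s,\mu}\le1\}$. For $\mu>1-1/s$ and $f\in W^\mu_s$, $f\sqrt w$ is identified with its continuous representative $\sum_k\langle f,\ell_k^{(\alpha)}\rangle\ell_k^{(\alpha)}\sqrt w$ (absolutely and uniformly convergent).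 Information operators: $G:L_{2,w}\to\ell_2$, $G(f^\delta)=\mathbf f^\delta$; for finite $\Omega\subset\mathbb N_0$, $G_\Omega(f)$ is the sequence whose $k$-th entry is $\langle f,\ell_k^{(\alpha)}\rangle$ if $k\in\Omega$ and $0$ otherwise. A recovery operator is any mapping $\psi:\ell_2\to C$. $\Psi$ is the set of all $\psi G$, and $\Psi_N$ is the set of all $\psi G_\Omega$ with $\operatorname{card}(\Omega)\le N$. For a map $A:L_{2,w}\to C$, $$e_\delta(W^\mu_s,A,C,\ell_p)=\sup_{f\in W^\mu_s}\ \sup_{f^\delta\in L_{2,w}:\|\mathbf f^\delta-\mathbf f\|_{\ell_p}\le\delta}\|(f-A(f^\delta))\sqrt w\|_C.$$ Set $\mathcal E_\delta(W^\mu_s,\Psi,C,\ell_p)=\inf_{A\in\Psi}e_\delta(W^\mu_s,A,C,\ell_p)$ and $R_{N,\delta}(W^\mu_s,\Psi_N,C,\ell_p)=\inf_{A\in\Psi_N}e_\delta(W^\mu_s,A,C,\ell_p)$. For a triangular array of reals $\nu=\{\nu_k^N\}$, $k=0,\dots,N$, $N\in\mathbb N$, $S_N^\nu f^\delta=\sum_{k=0}^N\nu_k^N\langle f^\delta,\ell_k^{(\alpha)}\rangle\ell_k^{(\alpha)}$. For $\theta>0$ the method belongs to $\mathcal S^\theta$ if there is $C(\nu)>0$ with $|1-\nu_k^N|\le C(\nu)(k/N)^\theta$ for all $N\in\mathbb N$, $0\le k\le N$ (with $0^\theta=0$). $A\asymp B$ means each of $A,B$ is bounded by a positive constant times the other.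 *)

(* Defs.v *)
From HB Require Import structures.
From mathcomp Require Import all_boot all_order all_algebra finmap.
From mathcomp Require Import all_classical all_reals all_analysis.

Set Implicit Arguments.
Unset Strict Implicit.
Unset Printing Implicit Defensive.

Import Order.TTheory GRing.Theory Num.Theory.
Import numFieldNormedType.Exports.

Local Open Scope classical_set_scope.
Local Open Scope ring_scope.

Definition half_line (R : realType) : set R := [set` `]0, +oo[].
Arguments half_line : clear implicits.

(* Euler's integral; only used for x > 0, where it converges. *)
Definition Gamma (R : realType) (x : R) : R :=
  \int[lebesgue_measure]_(t in half_line R) (t `^ (x - 1) * expR (- t)).

Definition weight (R : realType) (alpha t : R) : R := t `^ alpha * expR (- t).

(* Functions are represented by maps R -> R of which only the values on
   (0, +oo) matter; functions that agree almost everywhere there have the same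
   inner products, hence the same Laguerre coefficients. *)
Definition L2w (R : realType) (alpha : R) : set (R -> R) :=
  [set f : R -> R | measurable_fun (half_line R) f /\
     lebesgue_measure.-integrable (half_line R)
       (fun t => (weight alpha t * f t ^+ 2)%:E)].

Definition inner (R : realType) (alpha : R) (f g : R -> R) : R :=
  \int[lebesgue_measure]_(t in half_line R) (weight alpha t * f t * g t).

Definition laguerre (R : realType) (alpha : R) (k : nat) (t : R) : R :=
  \sum_(0 <= m < k.+1)
    Gamma (k%:R + alpha + 1) / (Gamma (m%:R + alpha + 1) * (k - m)`!%:R)
    * ((- t) ^+ m / m`!%:R).

Definition nlaguerre (R : realType) (alpha : R) (k : nat) (t : R) : R :=
  Num.sqrt (k`!%:R / Gamma (k%:R + alpha + 1)) * laguerre alpha k t.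

Definition coef (R : realType) (alpha : R) (f : R -> R) : nat -> R :=
  fun k => inner alpha f (nlaguerre alpha k).

Definition coef_on (R : realType) (alpha : R) (Omega : {fset nat})
    (f : R -> R) : nat -> R :=
  fun k => if k \in Omega then coef alpha f k else 0.

(* 1/p, with 1/oo = 0 *)
Definition invexp (R : realType) (p : \bar R) : R := fine (p^-1)%E.

Definition lpnorm (R : realType) (p : \bar R) (x : nat -> R) : \bar R :=
  ('N[ @counting nat R ]_p [EFin \o x])%E.

Definition ell2 (R : realType) : set (nat -> R) :=
  [set x | (lpnorm 2%:E x < +oo)%E].

(* Only used for 1 <= s, so that the last case does not occur. *)
Definition wnorm (R : realType) (alpha mu : R) (s : \bar R) (f : R -> R)
    : \bar R :=
  match s with
  | r%:E => ((\sum_(0 <= k <oo)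
       ((maxn 1 k)%:R `^ (r * mu) * `|coef alpha f k| `^ r)%:E) `^ r^-1)%E
  | +oo%E => ereal_sup
       (range (fun k : nat => ((maxn 1 k)%:R `^ mu * `|coef alpha f k|)%:E))
  | -oo%E => 0%E
  end.

Definition Wclass (R : realType) (alpha mu : R) (s : \bar R) : set (R -> R) :=
  [set f | L2w alpha f /\ (wnorm alpha mu s f <= 1)%E].

(* The continuous representative of f * sqrt w on (0, +oo), as the pointwise
   sum of the Laguerre expansion. *)
Definition fsqrtw (R : realType) (alpha : R) (f : R -> R) (t : R) : R :=
  limn (series (fun k =>
    coef alpha f k * nlaguerre alpha k t * Num.sqrt (weight alpha t))).

Definition normC (R : realType) (g : R -> R) : \bar R :=
  ereal_sup [set (`|g t|)%:E | t in half_line R].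

Definition recovery (R : realType) : set ((nat -> R) -> (R -> R)) :=
  [set psi | forall x, ell2 x -> {within half_line R, continuous (psi x)}].

Definition Psi (R : realType) (alpha : R) : set ((R -> R) -> (R -> R)) :=
  [set A | exists2 psi, @recovery R psi & A = psi \o coef alpha].

Definition PsiN (R : realType) (alpha : R) (N : nat)
    : set ((R -> R) -> (R -> R)) :=
  [set A | exists psi, exists Omega : {fset nat},
     [/\ @recovery R psi, (#|` Omega| <= N)%N & A = psi \o coef_on alpha Omega]].

Definition err (R : realType) (alpha mu : R) (s p : \bar R) (delta : R)
    (A : (R -> R) -> (R -> R)) : \bar R :=
  ereal_sup [set e | exists f fd : R -> R,
    [/\ Wclass alpha mu s f, L2w alpha fd,
        (lpnorm p (fun k => coef alpha fd k - coef alpha f k)%R <= delta%:E)%E &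
        e = normC (fun t =>
              fsqrtw alpha f t - A fd t * Num.sqrt (weight alpha t))]].

Definition opt_err (R : realType) (alpha mu : R) (s p : \bar R) (delta : R)
    : \bar R :=
  ereal_inf [set err alpha mu s p delta A | A in Psi alpha].

Definition opt_errN (R : realType) (alpha mu : R) (s p : \bar R) (N : nat)
    (delta : R) : \bar R :=
  ereal_inf [set err alpha mu s p delta A | A in PsiN alpha N].

Definition method (R : realType) (alpha : R) (nu : nat -> nat -> R) (N : nat)
    (fd : R -> R) : R -> R :=
  fun t => \sum_(0 <= k < N.+1) nu N k * coef alpha fd k * nlaguerre alpha k t.

(* nu N k stands for nu_k^N; nu belongs to S^theta when this holds for some
   C > 0. Note 0 `^ theta = 0 for theta > 0. *)
Definition in_S (R : realType) (theta C : R) (nu : nat -> nat -> R) : Prop :=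
  forall N k : nat, (0 < N)%N -> (k <= N)%N ->
    `|1 - nu N k| <= C * (k%:R / N%:R) `^ theta.

Definition asymp (R : realType) (c1 c2 : R) (A B : \bar R) : Prop :=
  (A <= c1%:E * B /\ B <= c2%:E * A)%E.

Definition rate (R : realType) (mu : R) (s p : \bar R) : R :=
  (mu + invexp s - 1) / (mu - invexp p + invexp s).

Definition N_range (R : realType) (mu : R) (s p : \bar R) (a b delta : R)
    (N : nat) : Prop :=
  let scale := delta `^ (- (1 / (mu - invexp p + invexp s))) in
  a * scale <= N%:R /\ N%:R <= b * scale.

(* Main.v *)
Require Import Defs.
From HB Require Import structures.
From mathcomp Require Import all_boot all_order all_algebra finmap.
From mathcomp Require Import all_classical all_reals all_analysis.
From mathcomp Require Import measurable_realfun ess_sup_inf ring lra.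

(** Write l_k for the orthonormal Laguerre functions and put
    gam = mu + 1/s - 1.

    Upper bounds only need |l_k(t) sqrt(w(t))| <= C uniformly in k and t. With
    t = r^2, the function z(r) = r^(alpha+1/2) e^(-r^2/2) L_k(r^2) solves
    z'' + Phi z = 0, Phi(r) = 4K - r^2 - (alpha^2 - 1/4)/r^2 and
    K = k + (alpha+1)/2. For r <= c/sqrt(K) it is controlled by its power
    series. Afterwards the energy z'^2 + Phi z^2 stays of order sqrt(K): as long
    as Phi increases because the Sonin function z^2 + z'^2/Phi decreases, later
    because the energy itself decreases. This bounds z^2/r until Phi drops to 1;
    the distance in r from there to the zero of Phi is bounded, so z changes
    little, and beyond it z^2 decreases. The error of a truncated multiplier
    method is then C times an l_1 norm of coefficients, split into tail, bias
    and noise.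

    For the lower bounds, the functions +-c (l_n + ... + l_(2n-1)) lie in the
    class and are compatible with the data 0, whereas at t = 1/(8n) all these
    l_k sqrt(w) are bounded below. *)

Set Implicit Arguments.
Unset Strict Implicit.
Unset Printing Implicit Defensive.
Import Order.TTheory GRing.Theory Num.Theory.
Import numFieldNormedType.Exports.
Local Open Scope classical_set_scope.
Local Open Scope ring_scope.

(** * The oscillator equation *)

(** At t = r^2 the quantity z^2 / r is w(t) L_k(t)^2, and the squared norm of L_k is g = Gamma(k +
    alpha + 1) / k!, so the goal is z^2 <= C g r. A single energy bound of order g sqrt(K) serves at
    both ends of the range. While Phi is of order K it yields z^2 of order g / sqrt(K), which is a
    multiple of g r because r starts at c / sqrt(K). Once Phi is only known to be at least 1 it
    yields z^2 of order g sqrt(K), but there r itself has order sqrt(K). No asymptotic expansion at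
    the turning point is involved.

    The exponents come from one balance. With D = mu - 1/p + 1/s and N of order delta^(-1/D), the
    tail N^(-gam) and the noise delta N^(1 - 1/p) have the same order. At that length a block of n
    equal coefficients of height n^(-mu - 1/s), the largest the class allows up to a constant, also
    has l_p norm of order delta. The constants must not depend on p; l_1 norms are therefore
    estimated by a pointwise split with absolute constants. *)

Lemma eq_ler {R : numDomainType} (x y : R) : x = y -> x <= y.
Proof. by move=> ->. Qed.

Lemma is_derive_ler {R : realType} (f df : R -> R) (a b : R) : a <= b ->
  (forall x, a <= x -> x <= b -> is_derive x 1 f (df x)) ->
  (forall x, a <= x -> x <= b -> df x <= 0) -> f b <= f a.
Proof.
move=> ab fE df0.
have [||x xab e] := @MVT_segment R f df a b ab.
- by move=> x /[!in_itv] /= /andP[ax xb]; apply: fE; exact: ltW.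
- apply: derivable_within_continuous => x /[!in_itv] /= /andP[ax xb].
  by have [] := fE x ax xb.
- rewrite -subr_le0 e; move: xab => /[!in_itv] /= /andP[ax xb].
  by rewrite mulr_le0_ge0 ?subr_ge0 ?df0.
Qed.

Lemma is_derive_ger {R : realType} (f df : R -> R) (a b : R) : a <= b ->
  (forall x, a <= x -> x <= b -> is_derive x 1 f (df x)) ->
  (forall x, a <= x -> x <= b -> 0 <= df x) -> f a <= f b.
Proof.
move=> ab fE df0; rewrite -lerN2.
apply: (@is_derive_ler R (- f) (- df) a b ab) => x ax xb.
  by have := fE x ax xb => ?; exact: is_deriveN.
by rewrite fctE oppr_le0 df0.
Qed.

Lemma is_derive_rw {R : realType} (f : R -> R) (x a b : R) :
  is_derive x 1 f a -> a = b -> is_derive x 1 f b.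
Proof. by move=> fa <-. Qed.

Lemma is_derive_mul {R : realType} (f g : R -> R) (x a b : R) :
  is_derive x 1 f a -> is_derive x 1 g b ->
  is_derive x 1 (fun t => f t * g t) (a * g x + f x * b).
Proof.
move=> fa gb; apply: (is_derive_rw (is_deriveM fa gb)).
by rewrite /GRing.scale /= addrC (mulrC a).
Qed.

Lemma is_derive_add {R : realType} (f g : R -> R) (x a b : R) :
  is_derive x 1 f a -> is_derive x 1 g b ->
  is_derive x 1 (fun t => f t + g t) (a + b).
Proof. by move=> fa gb; exact: is_deriveD. Qed.

Lemma is_derive_sub {R : realType} (f g : R -> R) (x a b : R) :
  is_derive x 1 f a -> is_derive x 1 g b ->
  is_derive x 1 (fun t => f t - g t) (a - b).
Proof. by move=> fa gb; exact: is_deriveB. Qed.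

Lemma is_derive_sqr {R : realType} (f : R -> R) (x a : R) :
  is_derive x 1 f a -> is_derive x 1 (fun t => f t ^+ 2) (2 * f x * a).
Proof.
by move=> fa; apply: (is_derive_rw (is_derive_mul fa fa)); ring.
Qed.

Lemma is_derive_inv {R : realType} (f : R -> R) (x a : R) : f x != 0 ->
  is_derive x 1 f a -> is_derive x 1 (fun t => (f t)^-1) (- (a / f x ^+ 2)).
Proof.
move=> fx0 fa; apply: (is_derive_rw (@is_deriveV R f x a 1 fx0 fa)).
by rewrite /GRing.scale /= mulNr mulrC.
Qed.

Section Oscillator.
Context {R : realType} (z v : R -> R) (q beta e A M : R).
Let Phi (r : R) := 4 * q ^+ 2 - r ^+ 2 - beta / r ^+ 2.
Hypotheses (dz : forall r : R, 0 < r -> is_derive r 1 z (v r))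
  (dv : forall r : R, 0 < r -> is_derive r 1 v (- (Phi r * z r))).
Let E (r : R) := v r ^+ 2 + Phi r * z r ^+ 2.
Let dPhi (r : R) := 2 * beta / r ^+ 3 - 2 * r.

Let is_derive_Phi (r : R) : 0 < r -> is_derive r 1 Phi (dPhi r).
Proof.
move=> r0.
have r2 : r ^+ 2 != 0 by rewrite expf_neq0// gt_eqF.
have h1 := is_derive_sqr (is_derive_id r (1:R)).
have h2 := @is_derive_inv R (fun t => t ^+ 2) r _ r2 h1.
have h3 := is_derive_mul (is_derive_cst beta r (1 : R)) h2.
apply: (is_derive_rw
  (is_deriveB (is_deriveB (is_derive_cst (4 * q ^+ 2) r (1 : R)) h1) h3)).
by rewrite /dPhi /cst; field; rewrite gt_eqF.
Qed.

Let is_derive_E (r : R) : 0 < r -> is_derive r 1 E (dPhi r * z r ^+ 2).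
Proof.
move=> r0.
apply: (is_derive_rw (is_deriveD (is_derive_sqr (dv r0))
  (is_derive_mul (is_derive_Phi r0) (is_derive_sqr (dz r0))))).
by ring.
Qed.

(** E' = Phi' z^2, where Phi' = 2 (beta - r^4) / r^3 changes sign only at r = beta^(1/4). *)
Let energy_decr (a b : R) : 0 < a -> a <= b -> beta <= a ^+ 4 -> E b <= E a.
Proof.
move=> a0 ab ba; apply: (is_derive_ler ab) => x ax xb.
  by apply: is_derive_E; exact: lt_le_trans ax.
have x0 : 0 < x by exact: lt_le_trans ax.
rewrite mulr_le0_ge0 ?sqr_ge0//.
have -> : dPhi x = 2 * (beta - x ^+ 4) / x ^+ 3.
  by rewrite /dPhi; field; rewrite gt_eqF.
rewrite mulr_le0_ge0 ?invr_ge0 ?exprn_ge0 ?(ltW x0)// mulr_ge0_le0//.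
by rewrite subr_le0 (le_trans ba)// lerXn2r// nnegrE ltW.
Qed.

(** E / Phi is the Sonin function z^2 + v^2 / Phi, with derivative - Phi' (v / Phi)^2. It replaces
    the energy where Phi' >= 0 and the energy may grow. *)
Let sonin_decr (a b : R) : 0 < a -> a <= b -> b ^+ 4 <= beta ->
  (forall x, a <= x -> x <= b -> 0 < Phi x) -> E b / Phi b <= E a / Phi a.
Proof.
move=> a0 ab ba Phi0.
pose d x := dPhi x * z x ^+ 2 * (Phi x)^-1 + E x * - (dPhi x / Phi x ^+ 2).
apply: (@is_derive_ler R (fun x => E x / Phi x) d a b ab) => x ax xb;
  have x0 : 0 < x by exact: lt_le_trans ax.
  apply: is_derive_mul; first exact: is_derive_E.
  by apply: is_derive_inv; [rewrite gt_eqF// Phi0|exact: is_derive_Phi].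
have -> : d x = - (dPhi x * (v x / Phi x) ^+ 2).
  by rewrite /d /E; field; rewrite gt_eqF// Phi0.
rewrite oppr_le0 mulr_ge0 ?sqr_ge0//.
have -> : dPhi x = 2 * (beta - x ^+ 4) / x ^+ 3.
  by rewrite /dPhi; field; rewrite gt_eqF.
rewrite divr_ge0 ?exprn_ge0 ?(ltW x0)// mulr_ge0//.
by rewrite subr_ge0 (le_trans _ ba)// lerXn2r// nnegrE ltW// (lt_le_trans x0).
Qed.

(* [q ^+ 2] is the K of the header, and the energy is followed from [e / q] on. *)
Hypotheses (q1 : 1 <= q) (e0 : 0 < e) (eq : e <= q) (be : `|beta| <= e ^+ 2).
Let r0 := e / q.
(** On the scale 1 / q of the oscillation, z' exceeds z by a factor q; [A] measures both. [M] is
    purely qualitative: it excludes growth at infinity and does not enter the final bound. *)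
Hypotheses (zr0 : z r0 ^+ 2 <= A / q) (vr0 : v r0 ^+ 2 <= A * q)
  (zM : forall r : R, r0 <= r -> z r ^+ 2 <= M).

Let q0 : 0 < q. Proof. exact: lt_le_trans q1. Qed.
Let r0_gt0 : 0 < r0. Proof. by rewrite divr_gt0. Qed.
Let A0 : 0 <= A.
Proof.
have := le_trans (sqr_ge0 _) zr0.
by rewrite pmulr_lge0// invr_gt0.
Qed.

Let beta_div (r : R) : r0 <= r -> `|beta / r ^+ 2| <= q ^+ 2.
Proof.
move=> rr; have r_gt0 : 0 < r by exact: lt_le_trans rr.
rewrite normrM normfV (ger0_norm (sqr_ge0 r)) ler_pdivrMr ?exprn_gt0//.
apply: (le_trans be); rewrite -exprMn.
rewrite lerXn2r ?nnegrE ?mulr_ge0 ?(ltW e0) ?(ltW q0) ?(ltW r_gt0)//.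
by move: rr; rewrite /r0 ler_pdivrMr// mulrC.
Qed.

Let r0_le1 : r0 <= 1.
Proof. by rewrite ler_pdivrMr// mul1r. Qed.

Let Phi_ge (r : R) : r0 <= r -> r ^+ 2 <= 2 * q ^+ 2 -> q ^+ 2 <= Phi r.
Proof.
move=> /beta_div; rewrite ler_norml => /andP[_ h] rq.
by rewrite /Phi; move: h rq; lra.
Qed.

Let Phi_le (r : R) : r0 <= r -> Phi r <= 5 * q ^+ 2.
Proof.
move=> /beta_div; rewrite ler_norml => /andP[h _].
by rewrite /Phi; have := sqr_ge0 r; move: h; lra.
Qed.

Let Aq0 : 0 <= A * q. Proof. by rewrite mulr_ge0// ltW. Qed.

Let energy_r0 : E r0 <= 6 * (A * q).
Proof.
have h : Phi r0 * z r0 ^+ 2 <= 5 * q ^+ 2 * (A / q).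
  apply: (@le_trans _ _ (5 * q ^+ 2 * z r0 ^+ 2)).
    by rewrite ler_wpM2r ?sqr_ge0// Phi_le.
  by rewrite ler_wpM2l// mulr_ge0 ?sqr_ge0.
have e1 : 5 * q ^+ 2 * (A / q) = 5 * (A * q) by field; rewrite gt_eqF.
by rewrite /E; move: h vr0; rewrite e1; lra.
Qed.

(** As beta <= e^2 <= q^2 <= q^4, the stretch where [Phi] increases lies inside the region where
    [Phi] is of order q^2. *)
Let sonin_range (r : R) : r ^+ 4 <= beta -> r ^+ 2 <= q ^+ 2.
Proof.
move=> rb; rewrite -(@ler_pXn2r _ 2)// ?nnegrE ?sqr_ge0//.
rewrite -exprM; apply: (le_trans rb); apply: (le_trans (ler_norm _)).
apply: (le_trans be); apply: (@le_trans _ _ (q ^+ 2)).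
  by rewrite lerXn2r// nnegrE ltW.
by rewrite ler_eXnr// exprn_ege1.
Qed.

(** On [r0, r] the values of [Phi] stay in [q^2, 5 q^2], so going from the energy to the Sonin
    function and back costs a factor 5; hence 30 = 6 * 5. *)
Let energy_le_sonin (r : R) : r0 <= r -> r ^+ 4 <= beta -> E r <= 30 * (A * q).
Proof.
move=> rr rb.
have Pq x : r0 <= x -> x <= r -> q ^+ 2 <= Phi x.
  move=> rx xr; apply: Phi_ge => //.
  have h : x ^+ 2 <= q ^+ 2.
    apply: sonin_range; apply: le_trans rb.
    have x0 : 0 <= x by rewrite (le_trans _ rx)// ltW.
    by rewrite lerXn2r// nnegrE// (le_trans x0).
  by have := sqr_ge0 q; lra.
have qq : 0 < q ^+ 2 by rewrite exprn_gt0.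
have P0 x : r0 <= x -> x <= r -> 0 < Phi x by move=> ? ?; apply/(lt_le_trans qq)/Pq.
have := sonin_decr r0_gt0 rr rb P0.
rewrite ler_pdivrMr ?P0// => /le_trans; apply.
have h : E r0 / Phi r0 <= 6 * (A * q) / q ^+ 2.
  apply: (@le_trans _ _ (6 * (A * q) / Phi r0)).
    by rewrite ler_wpM2r// invr_ge0 ltW// P0.
  rewrite ler_wpM2l//; first by rewrite mulr_ge0.
  by rewrite lef_pV2 ?posrE ?P0// Pq.
apply: (@le_trans _ _ (6 * (A * q) / q ^+ 2 * (5 * q ^+ 2))); last first.
  by apply/eq_ler; field; rewrite gt_eqF.
apply: (@le_trans _ _ (6 * (A * q) / q ^+ 2 * Phi r)).
  by rewrite ler_wpM2r// ltW// P0.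
by rewrite ler_wpM2l ?Phi_le// divr_ge0 ?sqr_ge0// mulr_ge0.
Qed.

Let energy_le (r : R) : r0 <= r -> E r <= 30 * (A * q).
Proof.
move=> rr; have [|/ltW br] := leP (r ^+ 4) beta; first exact: energy_le_sonin.
have [|rb] := leP beta (r0 ^+ 4).
  move=> /(energy_decr r0_gt0 rr) /le_trans; apply; apply: (le_trans energy_r0).
  by rewrite ler_wpM2r// ler_nat.
(* The maximum of [Phi] is at beta^(1/4): the Sonin function is used up to it, the energy from there
   on. *)
pose s := Num.sqrt (Num.sqrt beta).
have b0 : 0 <= beta by rewrite (le_trans _ (ltW rb))// exprn_ge0// ltW.
have s4 : s ^+ 4 = beta by rewrite (exprM s 2 2) !sqr_sqrtr// ?sqrtr_ge0.
have rs : r0 <= s.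
  by rewrite -(@ler_pXn2r _ 4)// ?nnegrE ?sqrtr_ge0 ?s4 ?(ltW rb)// ltW.
have sr : s <= r.
  by rewrite -(@ler_pXn2r _ 4)// ?nnegrE ?sqrtr_ge0 ?s4 ?(le_trans _ rr)// ltW.
apply: (@le_trans _ _ (E s)).
  by apply: energy_decr; rewrite ?s4// (lt_le_trans r0_gt0).
by apply: energy_le_sonin; rewrite ?s4.
Qed.

(** Here Phi >= q^2, so the energy gives z^2 <= 30 A / q, and 1 / q = r0 / e <= r / e. *)
Let bound_osc (r : R) : r0 <= r -> r ^+ 2 <= 2 * q ^+ 2 ->
  z r ^+ 2 <= 30 * A / e * r.
Proof.
move=> rr rq; have := energy_le rr; rewrite /E => h.
have h1 : q ^+ 2 * z r ^+ 2 <= 30 * (A * q).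
  apply: le_trans h; apply: (@le_trans _ _ (Phi r * z r ^+ 2)).
    by rewrite ler_wpM2r ?sqr_ge0// Phi_ge.
  by rewrite lerDr sqr_ge0.
have h2 : z r ^+ 2 <= 30 * A / q.
  rewrite ler_pdivlMr// -(@ler_pM2l _ q)//.
  by move: h1; congr (_ <= _); ring.
apply: (le_trans h2).
apply: (@le_trans _ _ (30 * A / e * r0)).
  by apply/eq_ler; rewrite /r0; field; rewrite !gt_eqF.
by rewrite ler_wpM2l// !mulr_ge0// invr_ge0 ltW.
Qed.

Let bound_mid (r : R) : 2 * q ^+ 2 <= r ^+ 2 -> r0 <= r ->
  r ^+ 2 <= 4 * q ^+ 2 - 2 -> z r ^+ 2 <= 30 * (A * q).
Proof.
move=> rq rr rq2; have := energy_le rr; rewrite /E; apply: le_trans.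
apply: (@le_trans _ _ (Phi r * z r ^+ 2)); last by rewrite lerDr sqr_ge0.
rewrite ler_peMl ?sqr_ge0//.
have qq : 0 < q ^+ 2 by rewrite exprn_gt0.
have : beta / r ^+ 2 <= 1.
  rewrite ler_pdivrMr ?mul1r; last by move: qq rq; lra.
  apply: (le_trans (ler_norm _)); apply: (le_trans be).
  apply: (@le_trans _ _ (q ^+ 2)); first by rewrite lerXn2r// nnegrE ltW.
  by move: qq rq; lra.
by rewrite /Phi; move: rq2; lra.
Qed.

(** Multiplied by r^2, the equation Phi = 0 is quadratic in r^2 with larger root 2 q^2 + [disc];
    [turn] is the outer turning point. *)
Let disc : R := Num.sqrt (4 * q ^+ 4 - beta).
Let turn : R := Num.sqrt (2 * q ^+ 2 + disc).

Let q2_ge1 : 1 <= q ^+ 2. Proof. exact: exprn_ege1. Qed.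

Let beta_le : - q ^+ 2 <= beta <= q ^+ 2.
Proof.
rewrite -ler_norml (le_trans be)//.
by rewrite lerXn2r// nnegrE ltW.
Qed.

Let q4E : q ^+ 4 = q ^+ 2 * q ^+ 2. Proof. by rewrite -exprD. Qed.

Let disc2 : disc ^+ 2 = 4 * q ^+ 4 - beta.
Proof. by rewrite sqr_sqrtr// q4E; move: q2_ge1 beta_le; nra. Qed.

Let disc_le : disc <= 2 * q ^+ 2 + 1.
Proof.
rewrite -(@ler_pXn2r _ 2)// ?nnegrE ?sqrtr_ge0//; last by move: q2_ge1; lra.
by rewrite disc2 q4E; move: q2_ge1 beta_le; nra.
Qed.

Let turn2 : turn ^+ 2 = 2 * q ^+ 2 + disc.
Proof. by rewrite sqr_sqrtr// addr_ge0 ?sqrtr_ge0// mulr_ge0 ?sqr_ge0. Qed.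

Let PhiE (r : R) : 0 < r ->
  Phi r = (disc ^+ 2 - (r ^+ 2 - 2 * q ^+ 2) ^+ 2) / r ^+ 2.
Proof. by move=> r_gt0; rewrite disc2 /Phi; field; rewrite gt_eqF. Qed.

(** Chosen so that 4 q^2 - r^2 = 2 here; since beta / r^2 <= 1, [Phi] is still at least 1 at this
    point. *)
Let r2 : R := Num.sqrt (4 * q ^+ 2 - 2).
Let r2E : r2 ^+ 2 = 4 * q ^+ 2 - 2.
Proof. by rewrite sqr_sqrtr//; move: q2_ge1; lra. Qed.

Let r2_ge1 : 1 <= r2.
Proof.
by rewrite -(@ler_pXn2r _ 2)// ?nnegrE ?sqrtr_ge0// r2E; move: q2_ge1; lra.
Qed.

(** The squares of [turn] and [r2] differ by at most 3, hence so do r and [r2]. Between them Phi >=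
    0, so v^2 <= 30 A q, and the mean value theorem with (x + y)^2 <= 2 (x^2 + y^2) gives 600 = 2
    (30 + 9 * 30). *)
Let bound_turn (r : R) : r2 <= r -> r <= turn -> z r ^+ 2 <= 600 * (A * q).
Proof.
move=> rr rt.
have r_gt0 : 0 < r by rewrite (lt_le_trans ltr01)// (le_trans r2_ge1).
have B2 : z r2 ^+ 2 <= 30 * (A * q).
  by apply: bound_mid; rewrite ?r2E// ?(le_trans r0_le1)//; move: q2_ge1; lra.
have [||xi /[!in_itv] /= /andP[r2x xr] zE] := @MVT_segment R z v r2 r rr.
- move=> x /[!in_itv] /= /andP[rx _]; apply: dz.
  by rewrite (lt_trans _ rx)// (lt_le_trans ltr01).
- apply: derivable_within_continuous => x /[!in_itv] /= /andP[rx _].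
  by have [] := @dz x _; rewrite ?(lt_le_trans _ rx)// (lt_le_trans ltr01).
have xi0 : 0 < xi by rewrite (lt_le_trans _ r2x)// (lt_le_trans ltr01).
have sq_le (x y : R) : 0 <= x -> x <= y -> x ^+ 2 <= y ^+ 2.
  by move=> x0 xy; rewrite lerXn2r// nnegrE (le_trans x0).
have Phi0 : 0 <= Phi xi.
  rewrite PhiE// divr_ge0 ?sqr_ge0// subr_ge0 sq_le//.
    have := sq_le _ _ (le_trans ler01 r2_ge1) r2x; rewrite r2E.
    by move: q2_ge1; lra.
  by have := sq_le _ _ (ltW xi0) (le_trans xr rt); rewrite turn2; lra.
have v2 : v xi ^+ 2 <= 30 * (A * q).
  have := @energy_le xi (le_trans r0_le1 (le_trans r2_ge1 r2x)).
  by rewrite /E; apply: le_trans; rewrite lerDl mulr_ge0// sqr_ge0.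
have d3 : r - r2 <= 3.
  have := sq_le _ _ (ltW r_gt0) rt; rewrite turn2 => h.
  have h2 : (r - r2) * (r + r2) <= 3.
    rewrite (_ : _ * _ = r ^+ 2 - r2 ^+ 2); last by ring.
    by rewrite r2E; move: disc_le h; lra.
  apply: le_trans h2; rewrite ler_peMr ?subr_ge0//.
  by move: r2_ge1 rr; lra.
have d9 : (r - r2) ^+ 2 <= 9.
  by have := @sq_le (r - r2) 3; rewrite subr_ge0 => /(_ rr d3); lra.
have vd : (v xi * (r - r2)) ^+ 2 <= 30 * (A * q) * 9.
  by rewrite exprMn ler_pM ?sqr_ge0.
have -> : z r = z r2 + v xi * (r - r2) by rewrite -zE; ring.
have := sqr_ge0 (z r2 - v xi * (r - r2)).
rewrite sqrrB sqrrD; move: vd B2 Aq0.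
by set a := z r2 * _; lra.
Qed.

Let turn_ge : r2 <= turn.
Proof.
rewrite -(@ler_pXn2r _ 2)// ?nnegrE ?sqrtr_ge0// turn2 r2E.
suff : 2 * q ^+ 2 - 2 <= disc by lra.
rewrite -(@ler_pXn2r _ 2)// ?nnegrE ?sqrtr_ge0//; last by move: q2_ge1; lra.
by rewrite disc2 q4E; move: q2_ge1 beta_le; nra.
Qed.

(** (z v)' = v^2 - Phi z^2, and Phi <= 0 beyond [turn]. *)
Let zv_ndecr (a b : R) : turn <= a -> a <= b -> z a * v a <= z b * v b.
Proof.
move=> ta ab.
pose d x := v x * v x + z x * - (Phi x * z x).
have pos x : a <= x -> 0 < x.
  by move=> ax; rewrite (lt_le_trans ltr01)// (le_trans r2_ge1)//
    (le_trans turn_ge)// (le_trans ta).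
apply: (@is_derive_ger R (fun x => z x * v x) d a b ab) => x ax xb.
  by apply: is_derive_mul; [exact/dz/pos|exact/dv/pos].
have Phi0 : Phi x <= 0.
  rewrite PhiE ?pos// mulr_le0_ge0 ?invr_ge0 ?sqr_ge0// subr_le0.
  have h : turn ^+ 2 <= x ^+ 2.
    by rewrite lerXn2r// ?nnegrE ?sqrtr_ge0 ?(ltW (pos _ _))// (le_trans ta).
  have d0 : 0 <= disc by exact: sqrtr_ge0.
  by rewrite lerXn2r// ?nnegrE//; move: h; rewrite turn2; lra.
rewrite /d -expr2; have -> : z x * - (Phi x * z x) = - Phi x * z x ^+ 2 by ring.
by rewrite addr_ge0 ?sqr_ge0// mulr_ge0 ?sqr_ge0 ?oppr_ge0.
Qed.

(* Past the turning point z^2 is convex; were it ever increasing, it would be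
   unbounded. *)
Let zv_le0 (a : R) : turn <= a -> z a * v a <= 0.
Proof.
move=> ta; rewrite leNgt; apply/negP => zv0.
set eps := z a * v a in zv0.
have tr0 : r0 <= turn by rewrite (le_trans r0_le1)// (le_trans r2_ge1).
have a0 : 0 < a by rewrite (lt_le_trans r0_gt0)// (le_trans tr0).
have M0 : 0 <= M by rewrite (le_trans _ (zM (lexx _)))// sqr_ge0.
(* To the right of a, (z^2)' = 2 z v >= 2 eps, so over this length z^2 gains M + 1 and exceeds its
   bound M. *)
pose b := a + (M + 1) / (2 * eps).
have ab : a <= b by rewrite lerDl divr_ge0// ?addr_ge0// mulr_ge0// ltW.
have : z a ^+ 2 - 2 * eps * a <= z b ^+ 2 - 2 * eps * b.
  pose d x := 2 * z x * v x - (0 * x + 2 * eps * 1).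
  apply: (@is_derive_ger R (fun x => z x ^+ 2 - 2 * eps * x) d a b ab) => x ax xb.
    apply: (is_deriveB (is_derive_sqr (dz (lt_le_trans a0 ax)))).
    exact: (is_derive_mul (is_derive_cst (2 * eps) x (1 : R)) (is_derive_id x (1 : R))).
  by rewrite /d; have := zv_ndecr ta ax; rewrite -/eps; lra.
have -> : 2 * eps * b = 2 * eps * a + (M + 1).
  by rewrite /b; field; rewrite gt_eqF.
have := zM (le_trans tr0 (le_trans ta ab)).
by have := sqr_ge0 (z a); lra.
Qed.

Let bound_exp (r : R) : turn <= r -> z r ^+ 2 <= z turn ^+ 2.
Proof.
move=> tr; pose d x := 2 * z x * v x.
apply: (@is_derive_ler R (fun x => z x ^+ 2) d turn r tr) => x tx xr.
  apply/is_derive_sqr/dz.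
  by rewrite (lt_le_trans ltr01)// (le_trans r2_ge1)// (le_trans turn_ge).
by rewrite /d -mulrA mulr_ge0_le0// zv_le0.
Qed.

Lemma oscillator_bound (r : R) : e / q <= r ->
  z r ^+ 2 <= A * (600 + 30 / e) * r.
Proof.
rewrite -/r0 => rr.
have r_gt0 : 0 < r by exact: lt_le_trans rr.
have e30 : 0 <= 30 / e by rewrite divr_ge0// ltW.
have [rq|/ltW rq] := leP (r ^+ 2) (2 * q ^+ 2).
  apply: (le_trans (bound_osc rr rq)); rewrite ler_wpM2r ?(ltW r_gt0)//.
  rewrite mulrDr mulrA (mulrC A 30) lerDr.
  by apply: mulr_ge0; [exact: A0|exact: ler0n].
(* From r^2 >= 2 q^2 on, q <= r, so a bound of order A q suffices. *)
suff h : z r ^+ 2 <= 600 * (A * q).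
  apply: (le_trans h); apply: (@le_trans _ _ (600 * (A * r))).
    apply: ler_wpM2l; first exact: ler0n.
    apply: ler_wpM2l; first exact: A0.
    rewrite -(@ler_pXn2r _ 2)// ?nnegrE ?ltW//.
    by move: rq q2_ge1; lra.
  have Ar : 0 <= A * r by rewrite mulr_ge0// ltW.
  have -> : A * (600 + 30 / e) * r = 600 * (A * r) + 30 / e * (A * r) by ring.
  by rewrite lerDl mulr_ge0.
have [rr2|/ltW rr2] := leP r r2.
  have := @bound_mid r rq rr; rewrite -r2E.
  rewrite lerXn2r ?nnegrE ?(ltW r_gt0)//; last by rewrite sqrtr_ge0.
  by move=> /(_ isT) /le_trans; apply; move: Aq0; lra.
have [|/ltW tr] := leP r turn; first exact: bound_turn.
by apply: (le_trans (bound_exp tr)); exact: bound_turn.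
Qed.

End Oscillator.

(** * Euler's integral *)

(** One half of the exponential absorbs the power: ln u <= u at u = t / (2 (a + 1)) bounds a ln t by
    t / 2 plus a constant. The other half of e^(-t) is left for integrability and limits. *)
Lemma powR_expR_half_bound {R : realType} (a t : R) : 0 <= a -> 0 < t ->
  t `^ a * expR (- (t / 2)) <= expR (a * ln (2 * (a + 1))).
Proof.
move=> a0 t0; have b0 : 0 < 2 * (a + 1) by rewrite mulr_gt0// ltr_wpDl.
rewrite /powR gt_eqF// -expRD ler_expR.
have h : ln t <= t / (2 * (a + 1)) + ln (2 * (a + 1)).
  have -> : ln t = ln (t / (2 * (a + 1))) + ln (2 * (a + 1)).
    by rewrite ln_div ?posrE// subrK.
  by rewrite lerD2r ltW// ln_sublinear// divr_gt0.
have : a * ln t <= a * (t / (2 * (a + 1)) + ln (2 * (a + 1))) by rewrite ler_wpM2l.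
have : a * (t / (2 * (a + 1))) <= t / 2.
  rewrite -subr_ge0.
  have -> : t / 2 - a * (t / (2 * (a + 1))) = t / (2 * (a + 1)).
    by field; rewrite gt_eqF// ltr_wpDl.
  by rewrite ltW// divr_gt0.
by rewrite mulrDr; lra.
Qed.

Lemma half_line_gt0 {R : realType} (t : R) : half_line R t -> 0 < t.
Proof. by rewrite /half_line /= in_itv /= andbT. Qed.

Lemma measurable_half_line {R : realType} : measurable (half_line R).
Proof. exact: measurable_itv. Qed.

Lemma cvg_expRN_half {R : realType} : expR (- (t / 2)) @[t --> +oo] --> (0 : R).
Proof.
apply: (@cvg_comp _ _ _ (fun t : R => t / 2) (fun t => expR (- t)) _ +oo).
  by apply: gt0_cvgMly.
exact: cvgr_expR.
Qed.

Lemma measurable_powR_expR {R : realType} (a : R) (D : set R) :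
  measurable_fun D (fun t : R => t `^ a * expR (- t)).
Proof.
apply: measurable_funTS; apply: measurable_funM; first exact: measurable_powR.
by apply: measurableT_comp.
Qed.

Lemma integrable_powR_expR {R : realType} (a : R) : 0 <= a ->
  lebesgue_measure.-integrable (half_line R)
    (fun t : R => (t `^ a * expR (- t))%:E).
Proof.
move=> a0; pose C := expR (a * ln (2 * (a + 1))).
have h0 : (0 : R) < 2^-1 by rewrite invr_gt0.
have C0 : 0 <= C by exact: expR_ge0.
apply: (@le_integrable _ _ R lebesgue_measure _ measurable_half_line _
  (fun t => (2 * C)%:E * (exponential_pdf (2^-1) t)%:E)%E).
- by apply/measurable_EFinP; exact: measurable_powR_expR.
- move=> t /half_line_gt0 t0; rewrite exponential_pdfE ?(ltW t0)// -EFinM !abse_EFin lee_fin.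
  rewrite !ger0_norm; last 2 first.
  + by rewrite mulr_ge0// mulr_ge0 ?expR_ge0// ltW.
  + by rewrite mulr_ge0 ?powR_ge0 ?expR_ge0.
  have -> : 2 * C * (2^-1 * expR (- 2^-1 * t)) = C * expR (- (t / 2)).
    by rewrite mulNr (mulrC _ t); field.
  have -> : expR (- t) = expR (- (t / 2)) * expR (- (t / 2)).
    by rewrite -expRD; congr expR; field.
  by rewrite mulrA ler_wpM2r ?expR_ge0// powR_expR_half_bound.
- apply: integrableZl; first exact: measurable_half_line.
  have := integrable_exponential_pdf h0.
  by apply: integrableS => //; exact: measurable_half_line.
Qed.

Lemma is_derive_expRN {R : realType} (t : R) :
  is_derive t 1 (fun t : R => expR (- t)) (- expR (- t)).
Proof.
apply: (is_derive_rw (is_derive1_comp (is_derive_expR (- t)) (is_deriveNid t (1:R)))).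
by rewrite mulrN1.
Qed.

Lemma is_derive_powR_expR {R : realType} (x t : R) : 0 < t ->
  is_derive t 1 (fun t : R => - (t `^ x * expR (- t)))
    (t `^ x * expR (- t) - x * (t `^ (x - 1) * expR (- t))).
Proof.
move=> t0.
have h := is_deriveN (is_derive_mul (is_derive1_powR x t0) (is_derive_expRN t)).
by apply: (is_derive_rw h); ring.
Qed.

Lemma cvg_powR_expR {R : realType} (a : R) : 0 <= a ->
  t `^ a * expR (- t) @[t --> +oo] --> 0.
Proof.
move=> a0; pose C := expR (a * ln (2 * (a + 1))).
apply: (@squeeze_cvgr _ _ _ _ (cst 0) (fun t => C * expR (- (t / 2)))).
- near=> t; have t0 : 0 < t by near: t; exact: nbhs_pinfty_gt.
  rewrite mulr_ge0 ?powR_ge0 ?expR_ge0//=.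
  have -> : expR (- t) = expR (- (t / 2)) * expR (- (t / 2)).
    by rewrite -expRD; congr expR; field.
  by rewrite mulrA ler_wpM2r ?expR_ge0// powR_expR_half_bound.
- exact: cvg_cst.
- rewrite -[X in _ --> X](mulr0 C); apply: cvgM; first exact: cvg_cst.
  exact: cvg_expRN_half.
Unshelve. all: by end_near. Qed.

Lemma continuous_powR_expR {R : realType} (a t : R) : 0 < t ->
  {for t, continuous (fun t : R => t `^ a * expR (- t))}.
Proof.
move=> t0; have := is_derive_powR_expR a t0 => h.
have := is_deriveN h => -[d _].
apply/differentiable_continuous/derivable1_diffP.
suff <- : - (fun t => - (t `^ a * expR (- t))) = (fun t : R => t `^ a * expR (- t)) by [].
by apply/funext => x; rewrite !fctE opprK.
Qed.

(** The case a = 0 is separate because 0^0 = 1 here. With this value the integrands are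
    right-continuous at 0, as the fundamental theorem on [0, x] requires. *)
Lemma Gamma_integrand_cvg0 {R : realType} (a : R) : 0 <= a ->
  t `^ a * expR (- t) @[t --> 0^'+] --> (0 : R) `^ a * expR (- 0).
Proof.
move=> a0; apply: cvgM.
  have [->|an0] := eqVneq a 0.
    rewrite powRr0; apply: cvg_near_cst; near=> t.
    by rewrite powRr0.
  by rewrite powR0//; apply: powR_cvg0; rewrite lt_neqAle eq_sym an0.
apply: cvg_at_right_filter.
apply: continuous_comp; last exact: continuous_expR.
exact: continuousN.
Unshelve. all: by end_near. Qed.

(** Integration by parts, as the fundamental theorem for F(t) = - t^x e^(-t), which vanishes at 0
    and at infinity. Its derivative changes sign at t = x, and the half-line version of the theorem
    is applied to a nonnegative integrand; hence the cut of (0, oo) at x. *)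
Lemma GammaS {R : realType} (x : R) : 1 <= x -> Gamma (x + 1) = x * Gamma x.
Proof.
move=> x1; have x0 : 0 < x by exact: lt_le_trans x1.
pose F (t : R) := - (t `^ x * expR (- t)).
pose g (t : R) := t `^ (x - 1) * expR (- t).
pose f (t : R) := t `^ x * expR (- t) - x * g t.
have x10 : 0 <= x - 1 by rewrite subr_ge0.
have ig : lebesgue_measure.-integrable (half_line R) (EFin \o g) by exact: integrable_powR_expR.
have iG : lebesgue_measure.-integrable (half_line R) (EFin \o (fun t => t `^ x * expR (- t))).
  by apply: integrable_powR_expR; exact: ltW.
have ixg : lebesgue_measure.-integrable (half_line R) (EFin \o (fun t => x * g t)).
  apply: (@eq_integrable _ _ _ lebesgue_measure _ _ (fun t => x%:E * (g t)%:E)%E) => //.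
    exact: measurable_half_line.
  by apply: integrableZl => //; exact: measurable_half_line.
have if_ : lebesgue_measure.-integrable (half_line R) (EFin \o f).
  apply: (@eq_integrable _ _ _ lebesgue_measure _ _
    (fun t => (t `^ x * expR (- t))%:E - (x * g t)%:E)%E) => //.
    exact: measurable_half_line.
  by apply: integrableB => //; exact: measurable_half_line.
apply/eqP; rewrite -subr_eq0; apply/eqP.
transitivity (\int[lebesgue_measure]_(t in half_line R) f t).
  rewrite /f RintegralB//; last exact: measurable_half_line.
  rewrite RintegralZl//; last exact: measurable_half_line.
  by rewrite /Gamma addrK.
have dF (t : R) : 0 < t -> is_derive t 1 F (f t) by exact: is_derive_powR_expR.
have F0 : F 0 = 0 by rewrite /F powR0 ?gt_eqF// mul0r oppr0.
have cf (t : R) : 0 < t -> {for t, continuous f}.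
  move=> t0; apply: continuousB; first exact: continuous_powR_expR.
  by apply: continuousM; [exact: cst_continuous|exact: continuous_powR_expR].
have cF (t : R) : 0 < t -> {for t, continuous F}.
  by move=> t0; apply: continuousN; exact: continuous_powR_expR.
have half1 : (\int[lebesgue_measure]_(t in `[0%R, x]) (f t)%:E = (F x)%:E - (F 0)%:E)%E.
  apply: continuous_FTC2 => //.
  - apply/continuous_within_itvP => //; split.
    + by move=> t /[!in_itv] /= /andP[t0 _]; exact: cf.
    + apply: cvgB; first by apply: Gamma_integrand_cvg0; exact: ltW.
      by apply: cvgM; [exact: cvg_cst|exact: Gamma_integrand_cvg0].
    + by apply: cvg_at_left_filter; exact: cf.
  - split.
    + by move=> t /[!in_itv] /= /andP[t0 _]; have [] := dF t t0.
    + by apply: cvgN; apply: Gamma_integrand_cvg0; exact: ltW.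
    + by apply: cvg_at_left_filter; exact: cF.
  - move=> t /[!in_itv] /= /andP[t0 _]; rewrite derive1E.
    by have [_ ->] := dF t t0.
have half2 : (\int[lebesgue_measure]_(t in `[x, +oo[) (f t)%:E = 0%:E - (F x)%:E)%E.
  apply: ge0_continuous_FTC2y => //.
  - move=> t xt; have t0 : 0 < t by exact: lt_le_trans xt.
    rewrite /f /g powRB ?powRr1 ?(ltW t0)// ?(gt_eqF t0) ?implybT//.
    rewrite (_ : _ - _ = t `^ x * expR (- t) * ((t - x) / t)); last first.
      by field; rewrite gt_eqF.
    by rewrite !mulr_ge0 ?powR_ge0 ?expR_ge0 ?subr_ge0 ?invr_ge0 ?(ltW t0).
  - apply/continuous_within_itvcyP; split.
    + move=> t /[!in_itv] /= /andP[xt _]; apply: cf; exact: lt_trans xt.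
    + by apply: cvg_at_right_filter; exact: cf.
  - by rewrite -oppr0; apply: cvgN; apply: cvg_powR_expR; exact: ltW.
  - by move=> t xt; have [] := dF t (lt_trans x0 xt).
  - by apply: cvg_at_right_filter; exact: cF.
  - move=> t /[!in_itv] /= /andP[xt _]; rewrite derive1E.
    by have [_ ->] := dF t (lt_trans x0 xt).
have mf (D : set R) : measurable_fun D f.
  apply: measurable_funB; first exact: measurable_powR_expR.
  by apply: measurable_funM; [exact: measurable_cst|exact: measurable_powR_expR].
rewrite /Rintegral.
have -> : half_line R = `]0%R, x]%classic `|` `]x, +oo[%classic.
  by rewrite /half_line -itv_bndbnd_setU// bnd_simp// ltW.
rewrite integral_setU_EFin//=; first last.
- apply/disj_set2P; rewrite -subset0 => t /= [] /[!in_itv] /= /andP[_ tx] /andP[xt _].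
  by move: xt; rewrite ltNge tx.
- exact: mf.
rewrite integral_itv_obnd_cbnd ?half1; last first.
  by apply/measurable_EFinP; exact: mf.
rewrite integral_itv_obnd_cbnd ?half2; last first.
  by apply/measurable_EFinP; exact: mf.
by rewrite F0 -!EFinB -EFinD /= subr0 sub0r subrr.
Qed.

(** The integrand is nonnegative and on [1, 2] at least e^(-2). *)
Lemma Gamma_gt0 {R : realType} (x : R) : 1 <= x -> 0 < Gamma x.
Proof.
move=> x1; have x10 : 0 <= x - 1 by rewrite subr_ge0.
pose g (t : R) := t `^ (x - 1) * expR (- t).
have ig : lebesgue_measure.-integrable (half_line R) (EFin \o g).
  exact: integrable_powR_expR.
have g0 t : 0 <= g t by rewrite mulr_ge0 ?powR_ge0 ?expR_ge0.
have sub : `[1%R, 2%R]%classic `<=` half_line R.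
  by move=> t; rewrite /half_line /= !in_itv /= andbT => /andP[t1 _]; rewrite (lt_le_trans ltr01).
have m12 : measurable (`[1%R, 2%R]%classic : set R) by exact: measurable_itv.
have i12 : lebesgue_measure.-integrable `[1%R, 2%R] (EFin \o g).
  by apply: integrableS ig => //; exact: measurable_half_line.
have mu12 : lebesgue_measure (`[1%R, 2%R]%classic : set R) = 1%:E.
  by rewrite lebesgue_measure_itv /= lte_fin ltr1n -EFinB; congr EFin; ring.
apply: (@lt_le_trans _ _ (expR (- 2))); first exact: expR_gt0.
apply: (@le_trans _ _ (\int[lebesgue_measure]_(t in `[1%R, 2%R]) g t)); last first.
  rewrite /Gamma /Rintegral fine_le ?(integrable_fin_num _ i12) ?(integrable_fin_num _ ig)//.
    exact: measurable_half_line.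
  apply: ge0_subset_integral => //; first exact: measurable_half_line.
    by case/integrableP: ig.
  by move=> t _; rewrite lee_fin.
have -> : expR (- 2) = \int[lebesgue_measure]_(t in `[1%R, 2%R]) expR (- 2 : R).
  by rewrite Rintegral_cst// [X in fine X]mu12 mulr1.
apply: le_Rintegral => //.
  apply/integrableP; split; first exact: measurable_cst.
  by rewrite integral_cst//= [X in (_ * X)%E]mu12 -EFinM ltry.
move=> t /= /[!in_itv] /= /andP[t1 t2]; rewrite /g.
apply: (@le_trans _ _ (1 * expR (- t))); first by rewrite mul1r ler_expR lerN2.
rewrite ler_wpM2r ?expR_ge0//.
have := @ge0_ler_powR R (x - 1) x10 1 t.
by rewrite powR1 !nnegrE ler01 (le_trans ler01 t1); exact.
Qed.

(** * Laguerre polynomials *)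

Section LaguerrePoly.
Context {R : realType}.
Implicit Types (alpha t : R) (k m n : nat).

Lemma Gamma_arg_ge1 alpha k : 0 <= alpha -> 1 <= k%:R + alpha + 1.
Proof. by move=> a0; rewrite lerDr addr_ge0. Qed.

Lemma Gamma_natS alpha k : 0 <= alpha ->
  Gamma (k.+1%:R + alpha + 1) = (k%:R + alpha + 1) * Gamma (k%:R + alpha + 1).
Proof.
move=> a0; rewrite -GammaS ?Gamma_arg_ge1//; congr Gamma.
by rewrite -natr1; ring.
Qed.

Lemma Gamma_nat_gt0 alpha k : 0 <= alpha -> 0 < Gamma (k%:R + alpha + 1).
Proof. by move=> a0; rewrite Gamma_gt0 ?Gamma_arg_ge1. Qed.

Definition laguerrep alpha k : {poly R} := \poly_(m < k.+1)
  (Gamma (k%:R + alpha + 1) / (Gamma (m%:R + alpha + 1) * (k - m)`!%:R)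
    * ((- 1) ^+ m / m`!%:R)).

Lemma laguerreE alpha k t : laguerre alpha k t = (laguerrep alpha k).[t].
Proof.
rewrite /laguerre horner_poly big_mkord; apply: eq_bigr => m _.
by rewrite (exprNn t) (mulrAC ((-1) ^+ m)) mulrA.
Qed.

(** This recurrence is the Laguerre differential equation read off coefficient by coefficient; it
    also controls the growth of the coefficients. *)
Lemma laguerrep_coefS alpha k m : 0 <= alpha ->
  m.+1%:R * (m%:R + alpha + 1) * (laguerrep alpha k)`_m.+1 =
  (m%:R - k%:R) * (laguerrep alpha k)`_m.
Proof.
move=> a0; rewrite !coef_poly !ltnS.
have [mk|km] := ltnP m k; last first.
  rewrite mulr0; have [|] := leqP m k; last by rewrite mulr0.
  by move=> mk; rewrite (_ : m = k) ?subrr ?mul0r//; apply/eqP; rewrite eqn_leq mk km.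
rewrite (ltnW mk) Gamma_natS// factS natrM.
have -> : (k - m)`!%:R = (k%:R - m%:R) * (k - m.+1)`!%:R :> R.
  by rewrite -natrB ?(ltnW mk)// -natrM -(subnSK mk) factS.
have G0 := @Gamma_nat_gt0 alpha m a0; rewrite exprS.
have km0 : (k%:R - m%:R : R) != 0 by rewrite subr_eq0 eqr_nat gt_eqF.
field.
rewrite km0 !pnatr_eq0 -!lt0n !fact_gt0 (gt_eqF G0) (gt_eqF (lt_le_trans ltr01 (Gamma_arg_ge1 m a0))).
by rewrite ?andbT /= addrC natr1 pnatr_eq0.
Qed.

Lemma laguerrep_ode alpha k : 0 <= alpha ->
  'X * (laguerrep alpha k)^`()^`() + ((alpha + 1)%:P - 'X) * (laguerrep alpha k)^`()
  + k%:R *: laguerrep alpha k = 0.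
Proof.
move=> a0; apply/polyP => m; have := laguerrep_coefS k m a0.
set p := laguerrep alpha k => h.
rewrite mulrBl !(coefD, coefN, coefXM, coefCM, coefZ, coef0, coef_deriv).
move: h => /eqP; rewrite -subr_eq0 => /eqP h.
rewrite -[RHS]h {h}; case: m => [|m] /=.
  by rewrite mulr1n; ring.
rewrite -(mulr_natl (p`_m.+2 *+ m.+2) m.+1) -(mulr_natl p`_m.+2 m.+2).
rewrite -(mulr_natl p`_m.+1 m.+1).
have e1 : m.+1%:R = m%:R + 1 :> R by rewrite natr1.
have e2 : m.+2%:R = m%:R + 1 + 1 :> R by rewrite !natr1.
rewrite e2 e1; move: p`_m.+2 p`_m.+1 => u w; ring.
Qed.

Lemma deriv_laguerrep alpha k :
  (laguerrep alpha k.+1)^`() = - laguerrep (alpha + 1) k.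
Proof.
apply/polyP => m; rewrite coef_deriv coefN !coef_poly ltnS.
case: ifP => mk; last by rewrite mul0rn oppr0.
rewrite subSS factS natrM -(mulr_natl (_ * _) m.+1).
have e n : n.+1%:R + alpha + 1 = n%:R + (alpha + 1) + 1.
  by rewrite -natr1; ring.
rewrite !e exprS.
have f0 : m`!%:R != 0 :> R by rewrite pnatr_eq0 -lt0n fact_gt0.
set g1 := Gamma _; set g2 := (Gamma _ * _)^-1.
by field; rewrite f0 addrC natr1 pnatr_eq0.
Qed.

Lemma coef0_laguerrep alpha k : (laguerrep alpha k)`_0 =
  Gamma (k%:R + alpha + 1) / (Gamma (alpha + 1) * k`!%:R).
Proof. by rewrite coef_poly/= subn0 expr0 fact0 divr1 mulr1 add0r. Qed.

Lemma coef0_laguerrep_gt0 alpha k : 0 <= alpha -> 0 < (laguerrep alpha k)`_0.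
Proof.
move=> a0; rewrite coef0_laguerrep divr_gt0 ?Gamma_nat_gt0//.
rewrite mulr_gt0 ?ltr0n ?fact_gt0//.
by have := Gamma_nat_gt0 0 a0; rewrite add0r.
Qed.

Lemma norm_laguerrep_coefS alpha k m : 0 <= alpha ->
  m.+1%:R * `|(laguerrep alpha k)`_m.+1| <= k%:R * `|(laguerrep alpha k)`_m|.
Proof.
move=> a0; have := congr1 Num.norm (laguerrep_coefS k m a0).
set p := laguerrep _ _.
have am : 1 <= m%:R + alpha + 1 := Gamma_arg_ge1 m a0.
rewrite !normrM normr_nat (ger0_norm (le_trans ler01 am)) => h.
apply: (@le_trans _ _ (m.+1%:R * (m%:R + alpha + 1) * `|p`_m.+1|)).
  by rewrite -mulrA ler_wpM2l// ler_peMl.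
rewrite h; have [km|mk] := ltnP k m.
  by rewrite /p coef_poly ltnS leqNgt km/= normr0 !mulr0.
rewrite ler_wpM2r// distrC -natrB// normr_nat ler_nat.
exact: leq_subr.
Qed.

(** For m <= k, |m - k| <= k and m + alpha + 1 >= 1, so by the recurrence the coefficients are
    dominated by those of L_k(0) e^(k t). This controls L_k for t up to order 1 / k. *)
Lemma norm_laguerrep_coef alpha k m : 0 <= alpha ->
  `|(laguerrep alpha k)`_m| <= (laguerrep alpha k)`_0 * (k%:R ^+ m / m`!%:R).
Proof.
move=> a0; elim: m => [|m IH].
  by rewrite fact0 expr0 divr1 mulr1 ger0_norm// ltW// coef0_laguerrep_gt0.
rewrite -(@ler_pM2l _ m.+1%:R)//; apply: (le_trans (norm_laguerrep_coefS k m a0)).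
apply: (@le_trans _ _ (k%:R * ((laguerrep alpha k)`_0 * (k%:R ^+ m / m`!%:R)))).
  by rewrite ler_wpM2l.
apply: eq_ler; rewrite factS natrM exprS; field.
by rewrite pnatr_eq0 -lt0n fact_gt0/= addrC natr1 pnatr_eq0.
Qed.

Lemma exp_sum_le (x : R) n : 0 <= x -> \sum_(m < n) x ^+ m / m`!%:R <= expR x.
Proof.
move=> x0; have := @is_cvg_series_exp_coeff R x => h.
have := @nondecreasing_cvgn_le R (series (exp_coeff x)) _ h n.
rewrite /series /= big_mkord; apply.
apply: nondecreasing_series => i _ _; exact: exp_coeff_ge0.
Qed.

Lemma norm_laguerrep alpha k t : 0 <= alpha -> 0 <= t ->
  `|(laguerrep alpha k).[t]| <= (laguerrep alpha k)`_0 * expR (k%:R * t).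
Proof.
move=> a0 t0; rewrite horner_coef; apply: (le_trans (ler_norm_sum _ _ _)).
apply: (@le_trans _ _ ((laguerrep alpha k)`_0 *
    \sum_(m < size (laguerrep alpha k)) (k%:R * t) ^+ m / m`!%:R)).
  rewrite mulr_sumr; apply: ler_sum => m _.
  rewrite normrM (ger0_norm (exprn_ge0 _ t0)) exprMn.
  apply: (@le_trans _ _ ((laguerrep alpha k)`_0 * (k%:R ^+ m / m`!%:R) * t ^+ m)).
    by rewrite ler_wpM2r ?exprn_ge0// norm_laguerrep_coef.
  by apply: eq_ler; ring.
by rewrite ler_wpM2l ?exp_sum_le ?mulr_ge0// ltW// coef0_laguerrep_gt0.
Qed.

Lemma norm_laguerrep_deriv alpha k t : 0 <= alpha -> 0 <= t ->
  `|(laguerrep alpha k)^`().[t]| <=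
  (laguerrep alpha k)`_0 * (k%:R * expR (k%:R * t)).
Proof.
move=> a0 t0; rewrite horner_coef; apply: (le_trans (ler_norm_sum _ _ _)).
apply: (@le_trans _ _ ((laguerrep alpha k)`_0 * (k%:R *
    \sum_(m < size (laguerrep alpha k)^`()) (k%:R * t) ^+ m / m`!%:R))).
  rewrite !mulr_sumr; apply: ler_sum => m _.
  rewrite normrM (ger0_norm (exprn_ge0 _ t0)) exprMn coef_deriv normrMn.
  rewrite -(mulr_natl `|(laguerrep alpha k)`_m.+1|).
  apply: (@le_trans _ _ (k%:R * ((laguerrep alpha k)`_0 * (k%:R ^+ m / m`!%:R)) * t ^+ m)).
    rewrite ler_wpM2r ?exprn_ge0//; apply: (le_trans (norm_laguerrep_coefS _ _ a0)).
    by rewrite ler_wpM2l// norm_laguerrep_coef.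
  by apply: eq_ler; ring.
by rewrite !ler_wpM2l ?exp_sum_le ?mulr_ge0// ltW// coef0_laguerrep_gt0.
Qed.

Lemma laguerrep_ge alpha k t : 0 <= alpha -> 0 <= t -> k%:R * t <= 4^-1 ->
  (laguerrep alpha k)`_0 / 2 <= (laguerrep alpha k).[t].
Proof.
move=> a0 t0 kt; set p := laguerrep alpha k.
have p0 : 0 < p`_0 by exact: coef0_laguerrep_gt0.
have sp : size p = (size p).-1.+1.
  by rewrite prednK// lt0n size_poly_eq0; apply/eqP => p00; rewrite p00 coef0 ltxx in p0.
(* The exponential majorant without its constant term bounds the deviation from L_k(0); since
   e^(1/4) <= 4/3, that is at most L_k(0) / 3. *)
suff h : `|p.[t] - p`_0| <= p`_0 * (expR (k%:R * t) - 1).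
  have e4 : expR (k%:R * t) <= 4 / 3.
    have h1 : expR (- (k%:R * t)) >= 3 / 4.
      by apply: le_trans (expR_ge1Dx _); lra.
    rewrite -[X in expR X]opprK expRN -(invf_div 3 4) lef_pV2 ?posrE ?expR_gt0//.
  have : p`_0 * (expR (k%:R * t) - 1) <= p`_0 * (1 / 3).
    by rewrite ler_wpM2l ?(ltW p0)//; lra.
  by move: h; rewrite ler_norml => /andP[h _]; lra.
rewrite horner_coef sp big_ord_recl expr0 mulr1 addrAC subrr add0r.
apply: (le_trans (ler_norm_sum _ _ _)).
have : \sum_(m < (size p).-1.+1) (k%:R * t) ^+ m / m`!%:R <= expR (k%:R * t).
  by rewrite exp_sum_le// mulr_ge0.
rewrite big_ord_recl expr0 fact0 divr1 -lerBrDl => h.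
apply: (@le_trans _ _ (p`_0 *
    \sum_(m < (size p).-1) (k%:R * t) ^+ lift ord0 m / (lift ord0 m)`!%:R)).
  rewrite mulr_sumr; apply: ler_sum => m _.
  rewrite normrM (ger0_norm (exprn_ge0 _ t0)) exprMn.
  apply: (@le_trans _ _ (p`_0 * (k%:R ^+ lift ord0 m / (lift ord0 m)`!%:R) * t ^+ lift ord0 m)).
    by rewrite ler_wpM2r ?exprn_ge0// norm_laguerrep_coef.
  by apply: eq_ler; ring.
by rewrite ler_wpM2l ?(ltW p0).
Qed.

End LaguerrePoly.

(** * Uniform bound on the Laguerre functions *)

Lemma expR_sqr {R : realType} (x : R) : expR x ^+ 2 = expR (2 * x).
Proof. by rewrite expr2 -expRD; congr expR; ring. Qed.

Lemma sqr_le_norm {R : realDomainType} (x y : R) : `|x| <= y -> x ^+ 2 <= y ^+ 2.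
Proof.
move=> xy; rewrite -(real_normK (num_real x)) lerXn2r// nnegrE//.
exact: le_trans xy.
Qed.

Lemma powR_sqr {R : realType} (x a : R) : (x `^ a) ^+ 2 = x `^ (a * 2).
Proof. by rewrite -powR_mulrn ?powR_ge0// -powRrM. Qed.

(** In logarithms this is ln (x / (x + 1)) <= - 1 / (x + 1). Together with the next lemma it
    replaces Stirling's formula. *)
Lemma powR_succ_ge {R : realType} (a x : R) : 0 <= a -> 0 < x ->
  x `^ a * expR (a / (x + 1)) <= (x + 1) `^ a.
Proof.
move=> a0 x0; have x1 : 0 < x + 1 by rewrite addr_gt0.
rewrite /powR !gt_eqF// -expRD ler_expR -mulrDr ler_wpM2l//.
have h : ln (1 + - (x + 1)^-1) <= - (x + 1)^-1.
  by apply: le_ln1Dx; rewrite ltrN2 invf_lt1// ltrDr.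
rewrite -lerBrDl -(opprK (x + 1)^-1) -lerN2 opprK opprB.
apply: le_trans h; rewrite -ln_div ?posrE// ler_ln ?posrE ?divr_gt0//.
  by apply: eq_ler; field; rewrite gt_eqF.
by rewrite subr_gt0 invf_lt1// ltrDr.
Qed.

Lemma powR_succ_le {R : realType} (a x : R) : 0 <= a -> 0 < x ->
  (x + 1) `^ a <= x `^ a * expR (a / x).
Proof.
move=> a0 x0; have x1 : 0 < x + 1 by rewrite addr_gt0.
rewrite /powR !gt_eqF// -expRD ler_expR -mulrDr ler_wpM2l//.
have h : ln (1 + x^-1) <= x^-1.
  by apply: le_ln1Dx; rewrite (@lt_trans _ _ 0)// ?oppr_lt0// invr_gt0.
rewrite -lerBlDl; apply: le_trans h; rewrite -ln_div ?posrE//.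
by rewrite mulrDl divff ?gt_eqF// mul1r.
Qed.

Section GammaRatio.
Context {R : realType} (alpha : R).
Hypothesis alpha0 : 0 <= alpha.

(** The squared norm of L_k in L_{2,w}, of order k^alpha for k >= 1. *)
Definition gamma_ratio (k : nat) : R := Gamma (k%:R + alpha + 1) / k`!%:R.

Lemma gamma_ratio_gt0 k : 0 < gamma_ratio k.
Proof. by rewrite divr_gt0 ?Gamma_nat_gt0// ltr0n fact_gt0. Qed.

Lemma gamma_ratioS k : gamma_ratio k.+1 = gamma_ratio k * (1 + alpha / k.+1%:R).
Proof.
rewrite /gamma_ratio Gamma_natS// factS natrM -(natr1 k); field.
by rewrite pnatr_eq0 -lt0n fact_gt0/= natr1 pnatr_eq0.
Qed.

Lemma gamma_ratio_le k : gamma_ratio k.+1 <= gamma_ratio 1 * k.+1%:R `^ alpha.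
Proof.
elim: k => [|k IH]; first by rewrite powR1 mulr1.
rewrite gamma_ratioS; have k0 : 0 < k.+1%:R :> R by [].
apply: (@le_trans _ _ (gamma_ratio 1 * (k.+1%:R `^ alpha *
    expR (alpha / k.+2%:R)))).
  rewrite mulrA ler_pM ?(ltW (gamma_ratio_gt0 _)) ?expR_ge1Dx//.
  by rewrite addr_ge0// divr_ge0.
rewrite ler_wpM2l ?(ltW (gamma_ratio_gt0 _))//.
by have := powR_succ_ge alpha0 k0; rewrite natr1.
Qed.

(** The shift by 1 + alpha lets the induction close: with x = k + 1 + alpha, the growth factor is 1
    + alpha / (k + 1) = 1 / (1 - alpha / x) >= e^(alpha / x), which is what [powR_succ_le] asks for
    between x and x + 1. *)
Lemma gamma_ratio_ge k :
  gamma_ratio 0 * (k%:R + 1 + alpha) `^ alpha <=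
  gamma_ratio k * (1 + alpha) `^ alpha.
Proof.
elim: k => [|k IH]; first by rewrite add0r.
rewrite gamma_ratioS -natr1.
have x0 : 0 < k%:R + 1 + alpha by rewrite natr1 ltr_wpDr.
have e0 : 1 + alpha / (k%:R + 1) = (k%:R + 1 + alpha) / (k%:R + 1).
  by field; rewrite natr1 pnatr_eq0.
apply: (@le_trans _ _ (gamma_ratio 0 * ((k%:R + 1 + alpha) `^ alpha *
    expR (alpha / (k%:R + 1 + alpha))))).
  rewrite ler_wpM2l ?(ltW (gamma_ratio_gt0 _))//.
  by have := powR_succ_le alpha0 x0; rewrite (addrAC (k%:R + 1)).
rewrite mulrA (mulrAC (gamma_ratio k)); apply: ler_pM => //.
  by apply: mulr_ge0; [exact/ltW/gamma_ratio_gt0|exact: powR_ge0].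
rewrite e0 -(opprK (alpha / _)) expRN -(invf_div (k%:R + 1)) lef_pV2 ?posrE.
- apply: le_trans (expR_ge1Dx _); apply: eq_ler; field.
  by rewrite gt_eqF.
- exact: expR_gt0.
- by rewrite divr_gt0// natr1.
Qed.

Lemma gamma_ratioE k : gamma_ratio k = Gamma (k%:R + alpha + 1) / k`!%:R.
Proof. by []. Qed.

End GammaRatio.
Opaque gamma_ratio.

(** A bound depending on p; it settles the finitely many small degrees and shows that each z is
    bounded. *)
Lemma poly_weight_bounded {R : realType} (a : R) (p : {poly R}) : 0 <= a ->
  exists M : R, forall t, 0 < t -> `|t `^ a * expR (- (t / 2)) * p.[t]| <= M.
Proof.
move=> a0; exists (\sum_(i < size p) `|p`_i| *
  expR ((a + i%:R) * ln (2 * (a + i%:R + 1)))) => t t0.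
rewrite horner_coef mulr_sumr; apply: (le_trans (ler_norm_sum _ _ _)).
apply: ler_sum => i _.
rewrite !normrM (ger0_norm (powR_ge0 t a)) (ger0_norm (expR_ge0 _)).
rewrite (ger0_norm (exprn_ge0 i (ltW t0))) [leLHS](_ : _ = `|p`_i| * (t `^ (a + i%:R) * expR (- (t / 2)))).
  by rewrite ler_wpM2l// powR_expR_half_bound// addr_ge0.
rewrite powRD ?(gt_eqF t0) ?implybT// powR_mulrn ?(ltW t0)//; ring.
Qed.

(** * Laguerre functions as solutions of the oscillator equation *)

Section LaguerreBound.
Context {R : realType} (alpha : R).
Hypothesis alpha0 : 0 <= alpha.
Let b : R := alpha + 2^-1.
Let beta : R := alpha ^+ 2 - 4^-1.
Let phi (r : R) := r `^ b * expR (- (r ^+ 2 / 2)).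
Let z (p : {poly R}) (r : R) := phi r * p.[r ^+ 2].
Let W (p : {poly R}) (r : R) :=
  (b * r^-1 - r) * p.[r ^+ 2] + 2 * r * p^`().[r ^+ 2].

Let is_derive_phi (r : R) : 0 < r ->
  is_derive r 1 phi (phi r * (b * r^-1 - r)).
Proof.
move=> r0.
have h1 := is_derive_mul (is_derive_sqr (is_derive_id r (1 : R)))
  (is_derive_cst (2^-1 : R) r (1 : R)).
have h2 := is_derive1_comp (is_derive_expR _) (is_deriveN h1).
apply: (is_derive_rw (is_derive_mul (is_derive1_powR b r0) h2)).
rewrite /phi powRB ?(gt_eqF r0) ?implybT// powRr1 ?(ltW r0)// /= /cst; field.
by rewrite gt_eqF.
Qed.

Let is_derive_horner2 (p : {poly R}) (r : R) :
  is_derive r 1 (fun r : R => p.[r ^+ 2]) (2 * r * p^`().[r ^+ 2]).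
Proof.
have h1 := is_derive_sqr (is_derive_id r (1 : R)).
have h := @is_derive1_comp R (horner p) (fun t => t ^+ 2) r _ _
  (is_derive_poly p (r ^+ 2)) h1.
by apply: (is_derive_rw h); ring.
Qed.

Let is_derive_z (p : {poly R}) (r : R) : 0 < r ->
  is_derive r 1 (z p) (phi r * W p r).
Proof.
move=> r0.
apply: (is_derive_rw (is_derive_mul (is_derive_phi r0) (is_derive_horner2 p r))).
by rewrite /W; ring.
Qed.

(** The Laguerre equation at t = r^2 in Liouville normal form: the prefactor [phi] is the one that
    removes the first-order term. *)
Let is_derive_v (k : nat) (r : R) : 0 < r -> let p := laguerrep alpha k in
  is_derive r 1 (fun r => phi r * W p r)
    (- ((4 * (k%:R + (alpha + 1) / 2) - r ^+ 2 - beta / r ^+ 2) * (phi r * p.[r ^+ 2]))).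
Proof.
move=> r0 p; have rn0 : r != 0 by rewrite gt_eqF.
have h1 := @is_derive_inv R id r 1 rn0 (is_derive_id r (1 : R)).
have h2 := is_derive_sub (is_derive_mul (is_derive_cst b r (1 : R)) h1)
  (is_derive_id r (1 : R)).
have h3 := is_derive_mul h2 (is_derive_horner2 p r).
have h4 := is_derive_mul (is_derive_mul (is_derive_cst (2 : R) r (1 : R))
  (is_derive_id r (1 : R))) (is_derive_horner2 p^`() r).
have h5 := is_derive_mul (is_derive_phi r0) (is_derive_add h3 h4).
have := congr1 (fun q : {poly R} => q.[r ^+ 2]) (laguerrep_ode k alpha0) => ode.
rewrite !hornerE /= -/p in ode; apply: (is_derive_rw h5); rewrite /W {h1 h2 h3 h4 h5}.
move: (phi r) p.[_] p^`().[_] p^`()^`().[_] ode => f p0 p1 p2 ode.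
have -> : p2 = - ((alpha + 1 - r ^+ 2) * p1 + k%:R * p0) / r ^+ 2.
  by apply: (mulfI (expf_neq0 2 rn0)); rewrite mulrCA divff ?expf_neq0// mulr1; lra.
by rewrite /b /beta /cst; field.
Qed.

Let phi_sqr (r : R) : 0 < r ->
  phi r ^+ 2 = r * ((r ^+ 2) `^ alpha * expR (- r ^+ 2)).
Proof.
move=> r0; rewrite /phi exprMn expR_sqr powR_sqr.
have -> : 2 * - (r ^+ 2 / 2) = - r ^+ 2 by field.
rewrite mulrA; congr (_ * _).
rewrite -(powR_mulrn 2 (ltW r0)) -powRrM.
have -> : b * 2 = 1 + 2 * alpha by rewrite /b; field.
by rewrite powRD ?powRr1 ?(ltW r0)// ?(gt_eqF r0) ?implybT.
Qed.

Let z_sqr (p : {poly R}) (r : R) : 0 < r ->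
  z p r ^+ 2 = r * ((r ^+ 2) `^ alpha * expR (- r ^+ 2) * p.[r ^+ 2] ^+ 2).
Proof. by move=> r0; rewrite /z exprMn phi_sqr// !mulrA. Qed.

(** The power series covers k t <= e^2. The value alpha + 1 ensures |beta| <= e^2 and b <= e, both
    used to start the energy at e / q. *)
Let e : R := alpha + 1.
Let B : R := gamma_ratio alpha 1 * (e ^+ 2) `^ alpha * expR (2 * e ^+ 2)
  / Gamma (alpha + 1) ^+ 2.
Let g := gamma_ratio alpha.
Let e0 : 0 < e. Proof. by rewrite ltr_wpDl. Qed.

(** L_k(0) = g k / Gamma(alpha + 1). Of the two factors [g k] in its square, one is kept for the
    normalisation; the other is at most a constant times k^alpha, and (k t)^alpha <= (e^2)^alpha. *)
Let initial_bound (k : nat) (t : R) : (0 < k)%N -> 0 <= t -> k%:R * t <= e ^+ 2 ->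
  t `^ alpha * expR (- t) *
    ((laguerrep alpha k)`_0 * expR (k%:R * t)) ^+ 2 <= g k * B.
Proof.
move=> k0 t0 kt.
have G0 : 0 < Gamma (alpha + 1) by rewrite Gamma_gt0// lerDr.
have -> : (laguerrep alpha k)`_0 = g k / Gamma (alpha + 1).
  rewrite coef0_laguerrep /g gamma_ratioE; field.
  by rewrite (gt_eqF G0) pnatr_eq0 -lt0n fact_gt0.
have gk : g k <= gamma_ratio alpha 1 * k%:R `^ alpha.
  by case: k k0 kt => // k _ _; exact: gamma_ratio_le.
have g0 := gamma_ratio_gt0 alpha0 k; have g1 := gamma_ratio_gt0 alpha0 1.
rewrite exprMn expR_sqr.
apply: (@le_trans _ _ (t `^ alpha * 1 *
   (g k * (gamma_ratio alpha 1 * k%:R `^ alpha) / Gamma (alpha + 1) ^+ 2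
     * expR (2 * e ^+ 2)))).
  apply: ler_pM.
  - by rewrite mulr_ge0 ?powR_ge0 ?expR_ge0.
  - by rewrite mulr_ge0 ?sqr_ge0 ?expR_ge0.
  - by rewrite ler_wpM2l ?powR_ge0// -expR0 ler_expR oppr_le0.
  - apply: ler_pM; rewrite ?sqr_ge0 ?expR_ge0//.
      rewrite exprMn exprVn ler_wpM2r ?invr_ge0 ?sqr_ge0//.
      by rewrite expr2 ler_wpM2l// ltW.
    by rewrite ler_expR ler_wpM2l.
rewrite /B [leLHS](_ : _ = g k * (gamma_ratio alpha 1 * (k%:R * t) `^ alpha *
  expR (2 * e ^+ 2) / Gamma (alpha + 1) ^+ 2)); last first.
  by rewrite powRM//; field; rewrite gt_eqF.
rewrite ler_wpM2l ?(ltW g0)// ler_wpM2r ?invr_ge0 ?sqr_ge0//.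
rewrite ler_wpM2r ?expR_ge0// ler_wpM2l ?(ltW g1)//.
by rewrite ge0_ler_powR// nnegrE ?sqr_ge0// mulr_ge0.
Qed.

Let large_bound (k : nat) (t : R) : e ^+ 2 <= k%:R -> 0 < t ->
  t `^ alpha * expR (- t) * (laguerrep alpha k).[t] ^+ 2 <=
  g k * (B + B * e * (1 + 3 * e) ^+ 2 * (600 + 30 / e)).
Proof.
move=> ek t0; set p := laguerrep alpha k.
have e1 : 1 <= e by rewrite lerDr.
have k0 : (0 < k)%N.
  rewrite -(ltr0n R); apply: lt_le_trans ek; exact: exprn_gt0.
have g0 := gamma_ratio_gt0 alpha0 k; have g1 := gamma_ratio_gt0 alpha0 1.
have G0 : 0 < Gamma (alpha + 1) by rewrite Gamma_gt0// lerDr.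
have B0 : 0 <= B.
  by rewrite /B divr_ge0 ?sqr_ge0// mulr_ge0 ?expR_ge0// mulr_ge0 ?powR_ge0// ltW.
have D0 : 0 <= B * e * (1 + 3 * e) ^+ 2 * (600 + 30 / e).
  apply: mulr_ge0; first by rewrite mulr_ge0 ?sqr_ge0// mulr_ge0// ltW.
  by apply: addr_ge0; [exact: ler0n|apply: divr_ge0; [exact: ler0n|exact: ltW]].
have pt (u : R) : 0 <= u -> p.[u] ^+ 2 <= (p`_0 * expR (k%:R * u)) ^+ 2.
  by move=> u0; apply: sqr_le_norm; exact: norm_laguerrep.
have [kt|/ltW kt] := leP (k%:R * t) (e ^+ 2).
  apply: (@le_trans _ _ (g k * B)); last by rewrite ler_wpM2l ?(ltW g0)// lerDl.
  apply: le_trans (initial_bound k0 (ltW t0) kt).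
  by rewrite ler_wpM2l ?pt ?(ltW t0)// mulr_ge0 ?powR_ge0 ?expR_ge0.
pose K : R := k%:R + (alpha + 1) / 2.
have K0 : 0 < K by rewrite ltr_wpDr ?ltr0n// divr_ge0// addr_ge0.
have eK : e ^+ 2 <= K by rewrite (le_trans ek)// lerDl divr_ge0// addr_ge0.
pose q := Num.sqrt K.
have q0 : 0 < q by rewrite sqrtr_gt0.
have q2 : q ^+ 2 = K by rewrite sqr_sqrtr// ltW.
have eq_ : e <= q by rewrite -(@ler_pXn2r _ 2)// ?nnegrE ?sqrtr_ge0 ?q2// ltW.
have q1 : 1 <= q by exact: le_trans eq_.
pose r0 := e / q.
have r00 : 0 < r0 by rewrite divr_gt0.
have r01 : r0 <= 1 by rewrite ler_pdivrMr// mul1r.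
have r02 : k%:R * r0 ^+ 2 <= e ^+ 2.
  rewrite exprMn exprVn q2 mulrA ler_pdivrMr// mulrC ler_wpM2l ?sqr_ge0//.
  by rewrite lerDl divr_ge0// addr_ge0.
have ini := initial_bound k0 (sqr_ge0 r0) r02.
(* [A] must dominate q z^2 and v^2 / q at r0. The factor e is r0 q. The factor 1 + 3 e comes from
   [W]: relative to the series bound, b / r0 - r0 contributes at most q (1 + e) and the derivative
   term at most 2 e q. *)
pose A := g k * (B * e * (1 + 3 * e) ^+ 2).
have be : `|beta| <= e ^+ 2.
  rewrite /beta /e ler_norml (_ : (alpha + 1) ^+ 2 = alpha ^+ 2 + 2 * alpha + 1).
    have := sqr_ge0 alpha; move: alpha0; set a2 := alpha ^+ 2 => a0 a20.
    by apply/andP; split; lra.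
  by ring.
have zr0 : z p r0 ^+ 2 <= A / q.
  rewrite z_sqr//; apply: (@le_trans _ _ (r0 * (g k * B))).
    rewrite ler_wpM2l ?(ltW r00)//; apply: le_trans ini.
    by rewrite ler_wpM2l ?pt ?sqr_ge0// mulr_ge0 ?powR_ge0 ?expR_ge0.
  rewrite (_ : r0 * (g k * B) = g k * B * e * 1 / q); last by rewrite /r0; ring.
  rewrite ler_wpM2r ?invr_ge0 ?(ltW q0)// (_ : A = g k * B * e * (1 + 3 * e) ^+ 2).
    apply: ler_wpM2l; first by rewrite mulr_ge0 ?(ltW e0)// mulr_ge0 ?(ltW g0).
    by rewrite exprn_ege1// lerDl mulr_ge0// ltW.
  by rewrite /A; ring.
have Wr0 : (W p r0) ^+ 2 <= (p`_0 * expR (k%:R * r0 ^+ 2) * (q * (1 + 3 * e))) ^+ 2.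
  apply: sqr_le_norm; set X := p`_0 * _.
  have X0 : 0 <= X by rewrite mulr_ge0 ?expR_ge0// ltW// coef0_laguerrep_gt0.
  have h1 : `|p.[r0 ^+ 2]| <= X by exact: norm_laguerrep (sqr_ge0 _).
  have h2 : `|p^`().[r0 ^+ 2]| <= k%:R * X.
    apply: (le_trans (norm_laguerrep_deriv _ alpha0 (sqr_ge0 _))).
    by apply: eq_ler; rewrite /X; ring.
  have b0 : 0 <= b by rewrite addr_ge0// invr_ge0.
  have h3 : `|b / r0 - r0| <= q + e * q.
    apply: (le_trans (ler_normB _ _)); rewrite !ger0_norm ?(ltW r00)//; last first.
      by rewrite divr_ge0// ltW.
    apply: lerD.
      rewrite /r0 invf_div mulrA ler_pdivrMr// mulrC ler_wpM2l ?(ltW q0)//.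
      by rewrite /b /e lerD2l; lra.
    by apply: (le_trans r01); rewrite mulr_ege1.
  have h4 : r0 * k%:R <= e * q.
    rewrite /r0 mulrAC ler_pdivrMr// -mulrA -expr2 q2 ler_wpM2l ?(ltW e0)//.
    by rewrite lerDl divr_ge0// addr_ge0.
  have r20 : 0 <= 2 * r0 by rewrite mulr_ge0// ltW.
  rewrite /W; apply: (le_trans (ler_normD _ _)).
  rewrite (normrM (b / r0 - r0)) (normrM (2 * r0)) (ger0_norm r20).
  apply: (@le_trans _ _ ((q + e * q) * X + 2 * (r0 * k%:R) * X)).
    apply: lerD; first by rewrite ler_pM.
    rewrite (_ : 2 * (r0 * k%:R) * X = 2 * r0 * (k%:R * X)); last by ring.
    by rewrite ler_wpM2l.
  have h5 : r0 * k%:R * X <= e * q * X by rewrite ler_wpM2r.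
  rewrite (_ : X * (q * (1 + 3 * e)) = (q + e * q) * X + 2 * (e * q * X)); last by ring.
  by rewrite lerD2l -(mulrA 2) ler_wpM2l.
have vr0 : (phi r0 * W p r0) ^+ 2 <= A * q.
  rewrite exprMn phi_sqr//.
  apply: (@le_trans _ _ (r0 * (g k * B) * (q * (1 + 3 * e)) ^+ 2)).
    rewrite -2!(mulrA r0); apply: ler_wpM2l; first exact: ltW.
    have w0 : 0 <= (r0 ^+ 2) `^ alpha * expR (- r0 ^+ 2).
      by rewrite mulr_ge0 ?powR_ge0 ?expR_ge0.
    apply: (le_trans (ler_wpM2l w0 Wr0)).
    rewrite (exprMn 2 (p`_0 * expR _)) (mulrA (_ * expR (- _))).
    by apply: ler_wpM2r ini; exact: sqr_ge0.
  apply: eq_ler; rewrite /A /r0; field.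
  by rewrite gt_eqF.
have b20 : 0 <= b / 2 by rewrite divr_ge0// addr_ge0// invr_ge0.
have [M zM] := @poly_weight_bounded R (b / 2) p b20.
have zM2 r : r0 <= r -> z p r ^+ 2 <= M ^+ 2.
  move=> rr; have r_gt0 : 0 < r by exact: lt_le_trans rr.
  apply: sqr_le_norm; have := zM (r ^+ 2) (exprn_gt0 _ r_gt0).
  rewrite -{1}(powR_mulrn 2 (ltW r_gt0)) -powRrM.
  by rewrite (_ : 2%:R * (b / 2) = b) //; field.
have st0 : 0 < Num.sqrt t by rewrite sqrtr_gt0.
have : z p (Num.sqrt t) ^+ 2 <= A * (600 + 30 / e) * Num.sqrt t.
  apply: (@oscillator_bound R (z p) (fun r => phi r * W p r) q beta e A
    (M ^+ 2)) => //.
  - by move=> r r_gt0; exact: is_derive_z.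
  - by move=> r r_gt0; rewrite q2; exact: is_derive_v.
  - rewrite -(@ler_pXn2r _ 2)// ?nnegrE ?(ltW r00) ?(ltW st0)//.
    rewrite sqr_sqrtr ?(ltW t0)// exprMn exprVn q2 ler_pdivrMr// mulrC.
    apply: (le_trans kt); rewrite ler_wpM2r ?(ltW t0)//.
    by rewrite lerDl divr_ge0// addr_ge0.
rewrite z_sqr// sqr_sqrtr ?(ltW t0)// mulrC ler_pM2r// => /le_trans; apply.
rewrite /A -mulrA ler_wpM2l ?(ltW g0)// lerDr//.
Qed.

Lemma laguerrep_weight_bounded : exists2 C : R, 0 < C & forall k t, 0 < t ->
  t `^ alpha * expR (- t) * (laguerrep alpha k).[t] ^+ 2 <= gamma_ratio alpha k * C.
Proof.
have small k : exists M : R, 0 <= M /\ forall t, 0 < t ->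
    t `^ alpha * expR (- t) * (laguerrep alpha k).[t] ^+ 2 <= gamma_ratio alpha k * M.
  have [M hM] := @poly_weight_bounded R (alpha / 2) (laguerrep alpha k)
    (divr_ge0 alpha0 (ler0n _ 2)).
  have g0 := gamma_ratio_gt0 alpha0 k.
  exists (M ^+ 2 / gamma_ratio alpha k); split.
    by rewrite divr_ge0 ?sqr_ge0// ltW.
  move=> t t0; rewrite [leRHS]mulrCA divff ?mulr1; last by rewrite gt_eqF.
  have := sqr_le_norm (hM t t0); rewrite !exprMn powR_sqr expR_sqr.
  rewrite (_ : alpha / 2 * 2 = alpha); last by field.
  by rewrite (_ : 2 * - (t / 2) = - t)//; field.
have {small} [M hM] := choice small.
(* From n on, e^2 <= k and [large_bound] applies; below n the separate bounds are summed. *)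
pose n := (Num.truncn (e ^+ 2)).+1.
pose C1 := B + B * e * (1 + 3 * e) ^+ 2 * (600 + 30 / e).
pose S := \sum_(k < n) M k.
have S0 : 0 <= S by apply: sumr_ge0 => k _; case: (hM k).
exists (`|C1| + S + 1).
  by rewrite ltr_wpDl// addr_ge0.
move=> k t t0; have g0 := gamma_ratio_gt0 alpha0 k.
have [kn|nk] := ltnP k n.
  have [M0 h] := hM k; apply: (le_trans (h t t0)).
  rewrite ler_wpM2l ?(ltW g0)//.
  have MS : M k <= S.
    rewrite /S (bigD1 (Ordinal kn))//= lerDl; apply: sumr_ge0 => i _.
    by case: (hM i).
  by apply: (le_trans MS); rewrite -addrA addrCA lerDl addr_ge0.
apply: (@le_trans _ _ (g k * C1)).
  apply: large_bound => //; apply: ltW.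
  apply: (lt_le_trans (truncnS_gt _)).
  by rewrite ler_nat.
rewrite ler_wpM2l ?(ltW g0)//.
apply: (le_trans (ler_norm _)); rewrite -addrA lerDl addr_ge0//.
Qed.

Lemma nlaguerre_bounded : exists2 C : R, 0 < C & forall k t, 0 < t ->
  `|nlaguerre alpha k t * Num.sqrt (weight alpha t)| <= C.
Proof.
have [C C0 hC] := laguerrep_weight_bounded.
exists (Num.sqrt C); first by rewrite sqrtr_gt0.
move=> k t t0; have g0 := gamma_ratio_gt0 alpha0 k.
rewrite -(@ler_pXn2r _ 2)// ?nnegrE ?sqrtr_ge0// real_normK ?num_real//.
rewrite sqr_sqrtr ?(ltW C0)// /nlaguerre laguerreE !exprMn.
have w0 : 0 <= weight alpha t by rewrite mulr_ge0 ?powR_ge0 ?expR_ge0.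
have -> : k`!%:R / Gamma (k%:R + alpha + 1) = (gamma_ratio alpha k)^-1.
  by rewrite gamma_ratioE invf_div.
rewrite !sqr_sqrtr ?invr_ge0 ?(ltW g0)//.
rewrite -mulrA ler_pdivrMl// mulrC.
exact: hC.
Qed.

End LaguerreBound.

(** * Moments and orthonormality *)

Section Moments.
Context {R : realType}.
Implicit Types (alpha t : R) (p q : {poly R}).

Lemma weightS alpha t : 0 < t -> weight alpha t * t = weight (alpha + 1) t.
Proof.
move=> t0; rewrite /weight mulrAC powRD ?(gt_eqF t0) ?implybT//.
by rewrite powRr1// ltW.
Qed.

Lemma eq_integrable_half_line (f g : R -> R) : (forall t, 0 < t -> f t = g t) ->
  lebesgue_measure.-integrable (half_line R) (EFin \o f) ->
  lebesgue_measure.-integrable (half_line R) (EFin \o g).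
Proof.
move=> fg; apply: eq_integrable; first exact: measurable_half_line.
by move=> t; rewrite inE => /half_line_gt0 t0; rewrite /= fg.
Qed.

Lemma integrable_half_lineZ (c : R) (f : R -> R) :
  lebesgue_measure.-integrable (half_line R) (EFin \o f) ->
  lebesgue_measure.-integrable (half_line R) (EFin \o (fun t => c * f t)).
Proof.
move=> i; apply: (@eq_integrable _ _ _ lebesgue_measure _ _
  (fun t => c%:E * (f t)%:E)%E) => //; first exact: measurable_half_line.
by apply: integrableZl => //; exact: measurable_half_line.
Qed.

Lemma integrable_half_lineD (f g : R -> R) :
  lebesgue_measure.-integrable (half_line R) (EFin \o f) ->
  lebesgue_measure.-integrable (half_line R) (EFin \o g) ->
  lebesgue_measure.-integrable (half_line R) (EFin \o (fun t => f t + g t)).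
Proof.
move=> i j; apply: (@eq_integrable _ _ _ lebesgue_measure _ _
  (fun t => (f t)%:E + (g t)%:E)%E) => //; first exact: measurable_half_line.
by apply: integrableD => //; exact: measurable_half_line.
Qed.

Lemma integrable_weight_poly alpha p : 0 <= alpha ->
  lebesgue_measure.-integrable (half_line R)
    (EFin \o (fun t => weight alpha t * p.[t])).
Proof.
elim/poly_ind: p alpha => [|p c IH] alpha a0.
  apply: (@eq_integrable_half_line (fun t => 0 * weight alpha t)).
    by move=> t _; rewrite horner0 mul0r mulr0.
  exact/integrable_half_lineZ/integrable_powR_expR.
apply: (@eq_integrable_half_line
    (fun t => weight (alpha + 1) t * p.[t] + c * weight alpha t)).
  by move=> t t0; rewrite -(weightS alpha t0) hornerMXaddC; ring.
apply: integrable_half_lineD; first by apply: IH; rewrite addr_ge0.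
exact/integrable_half_lineZ/integrable_powR_expR.
Qed.

Definition moment alpha p : R :=
  \int[lebesgue_measure]_(t in half_line R) (weight alpha t * p.[t]).

Lemma eq_half_line_Rintegral (f g : R -> R) : (forall t, 0 < t -> f t = g t) ->
  \int[lebesgue_measure]_(t in half_line R) f t =
  \int[lebesgue_measure]_(t in half_line R) g t.
Proof.
by move=> fg; apply: eq_Rintegral => t; rewrite inE => /half_line_gt0 /fg.
Qed.

Lemma momentD alpha p q : 0 <= alpha ->
  moment alpha (p + q) = moment alpha p + moment alpha q.
Proof.
move=> a0; rewrite /moment -RintegralD; last 3 first.
- exact: measurable_half_line.
- exact: integrable_weight_poly.
- exact: integrable_weight_poly.
by apply: eq_half_line_Rintegral => t t0; rewrite hornerD mulrDr.
Qed.

Lemma momentZ alpha c p : 0 <= alpha -> moment alpha (c *: p) = c * moment alpha p.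
Proof.
move=> a0; rewrite /moment -RintegralZl; last 2 first.
- exact: measurable_half_line.
- exact: integrable_weight_poly.
by apply: eq_half_line_Rintegral => t t0; rewrite hornerZ mulrCA.
Qed.

Lemma moment0 alpha : 0 <= alpha -> moment alpha 0 = 0.
Proof. by move=> a0; rewrite -(scale0r (0 : {poly R})) momentZ// mul0r. Qed.

Lemma momentN alpha p : 0 <= alpha -> moment alpha (- p) = - moment alpha p.
Proof. by move=> a0; rewrite -scaleN1r momentZ// mulN1r. Qed.

Lemma moment_sum alpha n (F : nat -> {poly R}) : 0 <= alpha ->
  moment alpha (\sum_(i < n) F i) = \sum_(i < n) moment alpha (F i).
Proof.
move=> a0; elim: n => [|n IH]; first by rewrite !big_ord0 moment0.
by rewrite !big_ord_recr /= momentD// IH.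
Qed.

Lemma momentMX alpha p : 0 <= alpha -> moment alpha (p * 'X) = moment (alpha + 1) p.
Proof.
move=> a0; apply: eq_half_line_Rintegral => t t0.
by rewrite -(weightS alpha t0) hornerMX; ring.
Qed.

Lemma momentC alpha (c : R) : 0 <= alpha -> moment alpha c%:P = c * Gamma (alpha + 1).
Proof.
move=> a0; rewrite -[c%:P]mulr1 mul_polyC momentZ//.
congr (_ * _); apply: eq_half_line_Rintegral => t t0.
by rewrite -polyC1 hornerC mulr1 addrK.
Qed.

(** Integration by parts reduced to algebra: multiplication by X raises alpha by 1, so induction on
    p for all alpha leaves only constants, which are [GammaS]. *)
Lemma moment_by_parts alpha p : 0 <= alpha ->
  moment (alpha + 1) p^`() + (alpha + 1) * moment alpha p = moment (alpha + 1) p.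
Proof.
elim/poly_ind: p alpha => [|p c IH] alpha a0.
  by rewrite deriv0 !moment0 ?addr_ge0// mulr0 addr0.
have a1 : 0 <= alpha + 1 by rewrite addr_ge0.
have := IH _ a1.
rewrite derivD derivC addr0 derivM derivX mulr1.
rewrite !momentD// !momentMX// !momentC//.
have -> : Gamma (alpha + 1 + 1) = (alpha + 1) * Gamma (alpha + 1).
  by rewrite GammaS// lerDr.
by move=> <-; ring.
Qed.

(* Green's formula for the operator D p = t p'' + (alpha + 1 - t) p', of which
   the Laguerre polynomials are eigenfunctions. *)
Lemma moment_laguerrep_green alpha k q : 0 <= alpha ->
  k%:R * moment alpha (laguerrep alpha k * q) =
  moment (alpha + 1) ((laguerrep alpha k)^`() * q^`()).
Proof.
move=> a0; set p := laguerrep alpha k.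
have a1 : 0 <= alpha + 1 by rewrite addr_ge0.
have := moment_by_parts (p^`() * q) a0.
rewrite derivM momentD// => parts.
have : moment alpha (('X * p^`()^`() + ((alpha + 1)%:P - 'X) * p^`()
    + k%:R *: p) * q) = 0.
  by rewrite laguerrep_ode// mul0r moment0.
have -> : ('X * p^`()^`() + ((alpha + 1)%:P - 'X) * p^`() + k%:R *: p) * q =
    (p^`()^`() * q) * 'X + (alpha + 1) *: (p^`() * q) + - (p^`() * q * 'X)
    + k%:R *: (p * q).
  by rewrite -!mul_polyC; ring.
rewrite !momentD// momentN// !momentZ// !momentMX//.
by move=> h; move: parts h; lra.
Qed.

Lemma laguerrep_deg0 alpha : 0 <= alpha -> laguerrep alpha 0 = 1%:P.
Proof.
move=> a0; apply/polyP => i; rewrite coef_poly coefC.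
case: i => [|i]//=; rewrite ?subnn fact0 expr0 divr1 !mulr1; apply: divff.
by rewrite gt_eqF// Gamma_nat_gt0.
Qed.

(** Green's formula and L_k' = - L_(k-1)^(alpha+1) lower both indices and raise alpha by 1, hence
    the induction over all alpha. If exactly one index is 0, a derivative vanishes. On the diagonal,
    k times the ratio for (alpha, k) is the ratio for (alpha + 1, k - 1). *)
Lemma moment_laguerrep alpha k j : 0 <= alpha ->
  moment alpha (laguerrep alpha k * laguerrep alpha j) =
  if k == j then gamma_ratio alpha k else 0.
Proof.
move=> a0; elim: k j alpha a0 => [|k IH] j alpha a0.
  case: j => [|j].
    rewrite laguerrep_deg0// -polyCM mulr1 momentC// mul1r eqxx gamma_ratioE.
    by rewrite fact0 divr1 add0r.
  apply: (mulfI (_ : j.+1%:R != 0)); first by rewrite pnatr_eq0.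
  rewrite (mulrC (laguerrep alpha 0)) moment_laguerrep_green// laguerrep_deg0// derivC mulr0.
  by rewrite moment0 ?addr_ge0// mulr0.
apply: (mulfI (_ : k.+1%:R != 0)); first by rewrite pnatr_eq0.
have a1 : 0 <= alpha + 1 by rewrite addr_ge0.
rewrite moment_laguerrep_green// deriv_laguerrep.
case: j => [|j]; first by rewrite laguerrep_deg0// derivC mulr0 moment0// mulr0.
rewrite deriv_laguerrep mulrNN IH// eqSS; case: ifP => _; last by rewrite mulr0.
rewrite !gamma_ratioE factS natrM invfM (mulrCA k.+1%:R) mulVKf ?pnatr_eq0//.
by congr (Gamma _ / _); rewrite -natr1; ring.
Qed.

(** An orthonormal expansion kept as a polynomial so that [moment] applies. It supplies both the
    extremal functions of the lower bound and the recovery by truncation. *)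
Definition lagsum alpha n (a : nat -> R) : {poly R} :=
  \sum_(j < n) (a j * Num.sqrt (gamma_ratio alpha j)^-1) *: laguerrep alpha j.

Lemma nlaguerreE alpha k t :
  nlaguerre alpha k t = Num.sqrt (gamma_ratio alpha k)^-1 * (laguerrep alpha k).[t].
Proof. by rewrite /nlaguerre laguerreE gamma_ratioE invf_div. Qed.

Lemma lagsumE alpha n a t :
  (lagsum alpha n a).[t] = \sum_(j < n) a j * nlaguerre alpha j t.
Proof.
rewrite /lagsum horner_sum; apply: eq_bigr => j _.
by rewrite hornerZ nlaguerreE mulrA.
Qed.

Lemma coef_lagsum alpha n a k : 0 <= alpha ->
  coef alpha (horner (lagsum alpha n a)) k = if (k < n)%N then a k else 0.
Proof.
move=> a0; set s := fun j => Num.sqrt (gamma_ratio alpha j)^-1.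
have g0 j : 0 < gamma_ratio alpha j by exact: gamma_ratio_gt0.
have -> : coef alpha (horner (lagsum alpha n a)) k =
    moment alpha (s k *: (lagsum alpha n a * laguerrep alpha k)).
  apply: eq_half_line_Rintegral => t t0.
  by rewrite nlaguerreE hornerZ hornerM /s; ring.
rewrite momentZ// /lagsum mulr_suml.
rewrite (@moment_sum alpha n
  (fun j => (a j * s j) *: laguerrep alpha j * laguerrep alpha k))//.
under eq_bigr => j _ do rewrite -scalerAl momentZ// moment_laguerrep//.
have [kn|nk] := ltnP k n; last first.
  rewrite big1 ?mulr0// => j _; rewrite ifF ?mulr0//.
  by apply/eqP => jk; move: (ltn_ord j); rewrite jk ltnNge nk.
rewrite (bigD1 (Ordinal kn))//= eqxx big1 ?addr0; last first.
  by move=> j jk; rewrite ifF ?mulr0//; apply: contraNF jk => /eqP jk; apply/eqP/val_inj.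
have h : s k ^+ 2 * gamma_ratio alpha k = 1.
  by rewrite sqr_sqrtr ?invr_ge0 ?(ltW (g0 k))// mulVf// gt_eqF.
by rewrite -[RHS]mulr1 -h /=; ring.
Qed.

Lemma L2w_poly alpha p : 0 <= alpha -> L2w alpha (horner p).
Proof.
move=> a0; split.
  by apply: measurable_funTS; apply: continuous_measurable_fun; exact: continuous_horner.
apply: (@eq_integrable_half_line (fun t => weight alpha t * (p ^+ 2).[t])).
  by move=> t t0; rewrite horner_exp.
exact: integrable_weight_poly.
Qed.

Lemma coef_horner0 alpha k : 0 <= alpha -> coef alpha (horner 0) k = 0.
Proof.
move=> a0; transitivity (moment alpha 0); last exact: moment0.
by apply: eq_half_line_Rintegral => t _; rewrite horner0 mulr0 mul0r.
Qed.

End Moments.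

(** * Sequence norms *)

Section SequenceEstimates.
Context {R : realType}.
Implicit Types (x : nat -> R) (s p : \bar R).

(** If u > l, then u = u^r u^(1 - r) <= u^r l^(1 - r). Summed over a sequence with a suitable level
    l, this acts as Hoelder's inequality. *)
Lemma ler_power_split (u l r : R) : 0 <= u -> 0 < l -> 1 <= r ->
  u <= l + u `^ r * l `^ (1 - r).
Proof.
move=> u0 l0 r1; have [ul|lu] := leP u l.
  by rewrite (le_trans ul)// lerDl mulr_ge0 ?powR_ge0.
have u_gt0 : 0 < u by exact: lt_trans lu.
rewrite (@le_trans _ _ (u `^ r * l `^ (1 - r)))//; last by rewrite lerDr ltW.
have -> : l `^ (1 - r) = (l `^ (r - 1))^-1 by rewrite -powRN opprB.
rewrite ler_pdivlMr ?powR_gt0// -[X in X * _](powRr1 u0).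
have -> : u `^ r = u `^ 1 * u `^ (r - 1).
  by rewrite -powRD ?(gt_eqF u_gt0) ?implybT//; congr (_ `^ _); ring.
rewrite ler_wpM2l ?powR_ge0//.
by rewrite ge0_ler_powR ?nnegrE ?subr_ge0// ltW.
Qed.

Lemma invexp_fin (r : R) : 1 <= r -> invexp r%:E = r^-1.
Proof. by move=> r1; rewrite /invexp inver gt_eqF// (lt_le_trans ltr01). Qed.

Lemma invexp_oo : invexp (+oo : \bar R) = 0.
Proof. by rewrite /invexp invey. Qed.

Lemma ler_nneseries_le (u : nat -> R) (M : R) n : (forall k, 0 <= u k) ->
  (\sum_(0 <= k <oo) (u k)%:E <= M%:E)%E -> \sum_(k < n) u k <= M.
Proof.
move=> u0 h; rewrite -lee_fin; apply: le_trans h.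
rewrite -sumEFin -(big_mkord xpredT (fun k => (u k)%:E)).
by apply: nneseries_lim_ge => k _; rewrite lee_fin.
Qed.

Lemma nneseries_finsupp (u : nat -> R) n : (forall k, 0 <= u k) ->
  (forall k, (n <= k)%N -> u k = 0) ->
  (\sum_(0 <= k <oo) (u k)%:E = (\sum_(k < n) u k)%:E)%E.
Proof.
move=> u0 un; rewrite (nneseries_split 0 n); last by move=> k _; rewrite lee_fin.
rewrite add0n eseries0 ?adde0; last by move=> k nk _; rewrite un.
by rewrite -sumEFin big_mkord.
Qed.

Lemma poweR_inv_le (x : \bar R) (M r : R) : (0 <= x)%E -> 0 <= M -> 0 < r ->
  (x `^ r^-1 <= M%:E)%E <-> (x <= (M `^ r)%:E)%E.
Proof.
move=> x0 M0 r0.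
case: x x0 => [x|_|//]; last by rewrite poweRyr ?invr_neq0 ?gt_eqF// !leye_eq.
rewrite lee_fin => x0; rewrite poweR_EFin !lee_fin; split => h.
  rewrite -(powRr1 x0) -(@mulVf _ r) ?gt_eqF// powRrM.
  by rewrite ge0_ler_powR ?nnegrE ?powR_ge0 ?(ltW r0).
rewrite -(powRr1 M0) -(@divff _ r) ?gt_eqF// powRrM.
by rewrite ge0_ler_powR ?nnegrE ?powR_ge0 ?invr_ge0 ?(ltW r0).
Qed.

Lemma lpnorm_finE (r : R) x : 1 <= r -> lpnorm r%:E x =
  ((\sum_(0 <= k <oo) (`|x k| `^ r)%:E) `^ r^-1)%E.
Proof. by move=> r1; rewrite /lpnorm Lnorm_counting// (lt_le_trans ltr01). Qed.

(** This turns the essential supremum behind the l_oo norm into a plain supremum. *)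
Lemma counting_eq0 (A : set nat) : @counting nat R A = 0%E -> A = set0.
Proof.
rewrite /counting; case: asboolP => // Afin /eqP; rewrite eqe pnatr_eq0 cardfs_eq0.
move=> /eqP A0; rewrite -subset0 => k Ak.
have : k \in fset_set A by rewrite in_fset_set// inE.
by rewrite A0 inE.
Qed.

Lemma lpnorm_oo_le x (M : R) : (lpnorm +oo%E x <= M%:E)%E <->
  (forall k, `|x k| <= M).
Proof.
rewrite /lpnorm unlock ifT; last first.
  rewrite lt0e measure_ge0 andbT; apply/eqP => /counting_eq0 h.
  by have : [set: nat] 0%N by []; rewrite h.
split=> [/ess_supP [A [_ /counting_eq0 -> h]] k|h].
  by rewrite leNgt; apply/negP => Mx; apply: (h k); rewrite /= lee_fin leNgt Mx.
by apply/ess_supP; apply: nearW => k; rewrite /= lee_fin.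
Qed.

Lemma lpnorm_sum_le p x (delta : R) n : (1 <= p)%E -> 0 < delta -> (0 < n)%N ->
  (lpnorm p x <= delta%:E)%E ->
  \sum_(k < n) `|x k| <= 2 * (delta * n%:R `^ (1 - invexp p)).
Proof.
move=> p1 d0 n0; have n_gt0 : 0 < n%:R :> R by rewrite ltr0n.
case: p p1 => [r|_|//]; last first.
  move=> /lpnorm_oo_le h; rewrite invexp_oo subr0 powRr1//.
  apply: (@le_trans _ _ (\sum_(k < n) delta)); first exact: ler_sum.
  rewrite sumr_const card_ord -(mulr_natr delta n) ler_peMl ?ler1n//.
  by rewrite mulr_ge0// ltW.
rewrite lee_fin => r1; have r0 : 0 < r by exact: lt_le_trans r1.
rewrite lpnorm_finE// invexp_fin// poweR_inv_le ?(ltW d0)//; last first.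
  by apply: nneseries_ge0 => k _ _; rewrite lee_fin powR_ge0.
move=> /(ler_nneseries_le n (fun k => powR_ge0 _ _)) h.
(* At this level both parts of the split sum to at most delta n^(1 - 1/p), whence the factor 2. *)
pose l := delta * n%:R `^ (- r^-1).
have l0 : 0 < l by rewrite mulr_gt0// powR_gt0.
apply: (@le_trans _ _ (\sum_(k < n) (l + `|x k| `^ r * l `^ (1 - r)))).
  by apply: ler_sum => k _; exact: ler_power_split.
rewrite big_split /= sumr_const card_ord -mulr_suml.
have nl : l *+ n = delta * n%:R `^ (1 - r^-1).
  rewrite -(mulr_natr l n) /l -mulrA; congr (_ * _).
  rewrite -{2}(powRr1 (ltW n_gt0)) -powRD ?(gt_eqF n_gt0) ?implybT//.
  by rewrite addrC.
rewrite nl mulrDl mul1r lerD2l.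
apply: (@le_trans _ _ (delta `^ r * l `^ (1 - r))).
  by rewrite ler_wpM2r// powR_ge0.
rewrite /l powRM ?powR_ge0 ?(ltW d0)// mulrA -powRD ?(gt_eqF d0) ?implybT//.
rewrite -powRrM (_ : r + (1 - r) = 1); last by ring.
rewrite powRr1 ?(ltW d0)// (_ : - r^-1 * (1 - r) = 1 - r^-1)//.
by field; rewrite gt_eqF.
Qed.

(** Coefficient profile of the extremal functions: on [n, 2n) the weights k^mu agree up to a factor
    2^mu, and the l_p norm is c n^(1/p). *)
Definition block (n : nat) (c : R) (k : nat) : R :=
  if (n <= k < n.*2)%N then c else 0.

Lemma block_sum n (F : nat -> R) :
  \sum_(k < n.*2) (if (n <= k < n.*2)%N then F k else 0) = \sum_(k < n) F (n + k)%N.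
Proof.
rewrite -(big_mkord xpredT (fun k => if (n <= k < n.*2)%N then F k else 0)).
rewrite (@big_cat_nat _ _ _ n)//=; last by rewrite -addnn leq_addr.
rewrite big1_seq ?add0r; last first.
  by move=> k /= /[!mem_index_iota] /andP[_ kn]; rewrite leqNgt kn.
rewrite -{1}(add0n n) -addnn big_addn addnK big_mkord.
by apply: eq_bigr => k _; rewrite addnC leq_addr ltn_add2l ltn_ord.
Qed.

Lemma lpnorm_block p x n (c delta : R) : (1 <= p)%E -> 0 <= c -> 0 <= delta ->
  (forall k, `|x k| = block n c k) -> c * n%:R `^ invexp p <= delta ->
  (lpnorm p x <= delta%:E)%E.
Proof.
move=> p1 c0 d0 xE; case: p p1 => [r|_|//]; last first.
  rewrite invexp_oo powRr0 mulr1 => cd; apply/lpnorm_oo_le => k.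
  by rewrite xE /block; case: ifP.
rewrite lee_fin => r1; have r0 : 0 < r by exact: lt_le_trans r1.
rewrite invexp_fin// => cd; rewrite lpnorm_finE// poweR_inv_le//; last first.
  by apply: nneseries_ge0 => k _ _; rewrite lee_fin powR_ge0.
rewrite (@nneseries_finsupp _ n.*2); last 2 first.
- by move=> k; rewrite powR_ge0.
- by move=> k nk; rewrite xE /block [X in _ && X]ltnNge nk andbF powR0// gt_eqF.
have -> : \sum_(k < n.*2) `|x k| `^ r = c `^ r *+ n.
  under eq_bigr => k _.
    rewrite (_ : _ `^ _ = if (n <= k < n.*2)%N then c `^ r else 0); last first.
      by rewrite xE /block; case: ifP => _; rewrite // powR0 ?gt_eqF.
    over.
  by rewrite (block_sum n (fun=> c `^ r)) sumr_const card_ord.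
rewrite lee_fin -(mulr_natr _ n).
apply: (@le_trans _ _ ((c * n%:R `^ r^-1) `^ r)).
  rewrite powRM ?powR_ge0// -powRrM mulVf ?gt_eqF//.
  by rewrite powRr1.
by rewrite ge0_ler_powR ?nnegrE ?mulr_ge0 ?powR_ge0 ?(ltW r0).
Qed.

Section Class.
Variables (alpha mu : R) (s : \bar R).
Hypotheses (s1 : (1 <= s)%E) (mu0 : 0 < mu).
Let gam : R := mu + invexp s - 1.

(* Splitting |f_k| at the level k^(-1-gam) produces the same powers of k for all
   s, including s = oo. *)
Lemma Wclass_decomp f : Wclass alpha mu s f -> exists b : nat -> R,
  [/\ forall k, 0 <= b k, forall n, \sum_(k < n) b k <= 1 &
      forall k, `|coef alpha f k| <= (maxn 1 k)%:R `^ (- 1 - gam)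
                                   + (maxn 1 k)%:R `^ (- gam) * b k].
Proof.
move=> [_]; rewrite /wnorm /gam; case: s s1 => [r|_|//]; last first.
  move=> h; exists (fun=> 0); split => // [n|k].
    by rewrite sumr_const mul0rn.
  have m0 : (0 : R) < (maxn 1 k)%:R by rewrite ltr0n leq_max.
  rewrite invexp_oo addr0 mulr0 addr0 (_ : - 1 - (mu - 1) = - mu); last by ring.
  rewrite powRN -[leRHS]mul1r ler_pdivlMr ?powR_gt0// mulrC -lee_fin.
  by apply: le_trans h; apply: ereal_sup_ubound; exists k.
rewrite lee_fin => r1; have r0 : 0 < r by exact: lt_le_trans r1.
rewrite invexp_fin// poweR_inv_le ?ler01//; last first.
  by apply: nneseries_ge0 => k _ _; rewrite lee_fin mulr_ge0// powR_ge0.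
rewrite powR1 => h.
exists (fun k => (maxn 1 k)%:R `^ (r * mu) * `|coef alpha f k| `^ r); split.
- by move=> k; rewrite mulr_ge0// powR_ge0.
- by move=> n; apply: ler_nneseries_le h => k; rewrite mulr_ge0// powR_ge0.
move=> k; have m0 : (0 : R) < (maxn 1 k)%:R by rewrite ltr0n leq_max.
set m := (maxn 1 k)%:R in m0 *.
set g := mu + r^-1 - 1.
have l0 : 0 < m `^ (- 1 - g) by rewrite powR_gt0.
apply: (le_trans (ler_power_split (normr_ge0 _) l0 r1)); rewrite lerD2l.
rewrite mulrCA mulrC mulrA -powRrM -powRD ?(gt_eqF m0) ?implybT//.
rewrite (_ : (- 1 - g) * (1 - r) = r * mu - g)//.
by rewrite /g; field; rewrite gt_eqF.
Qed.

(** In the height, 2^(-mu) pays for k < 2n in the weight k^mu, and n^(-1/s) for having n terms. *)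
Lemma wnorm_block f n : (0 < n)%N ->
  (forall k, `|coef alpha f k| =
    block n (2 `^ (- mu) * n%:R `^ (- mu - invexp s)) k) ->
  (wnorm alpha mu s f <= 1)%E.
Proof.
move=> n0 fE; set c := 2 `^ (- mu) * _ in fE.
have n_gt0 : 0 < n%:R :> R by rewrite ltr0n.
have c0 : 0 <= c by rewrite mulr_ge0 ?powR_ge0.
have mle k : (k < n.*2)%N -> (maxn 1 k)%:R `^ mu * c <= n%:R `^ (- invexp s).
  move=> kn; rewrite /c mulrA.
  have -> : n%:R `^ (- mu - invexp s) = n%:R `^ (- mu) * n%:R `^ (- invexp s).
    by rewrite -powRD// (gt_eqF n_gt0) implybT.
  rewrite mulrA ler_piMl ?powR_ge0// -mulrA -powRM ?ler0n// powRN.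
  rewrite ler_pdivrMr ?powR_gt0 ?mulr_gt0// mul1r.
  rewrite ge0_ler_powR ?nnegrE ?(ltW mu0) ?mulr_ge0//.
  rewrite -natrM mul2n ler_nat geq_max (ltnW kn) andbT.
  by rewrite -addnn (leq_trans n0)// leq_addr.
move: s1 mle; rewrite /wnorm; case sE : s => [r| |] // s1' mle; last first.
  apply: ub_ereal_sup => _ [k _ <-]; rewrite lee_fin fE /block.
  case: ifP => [/andP[_ kn]|_]; last by rewrite mulr0.
  by rewrite (le_trans (mle _ kn))// invexp_oo oppr0 powRr0.
move: s1'; rewrite lee_fin => r1; have r0 : 0 < r by exact: lt_le_trans r1.
apply/poweR_inv_le => //.
  by apply: nneseries_ge0 => k _ _; rewrite lee_fin mulr_ge0// powR_ge0.
have fr k : (maxn 1 k)%:R `^ (r * mu) * `|coef alpha f k| `^ r =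
    if (n <= k < n.*2)%N then ((maxn 1 k)%:R `^ mu * c) `^ r else 0.
  rewrite fE /block; case: ifP => _; last by rewrite powR0 ?mulr0// gt_eqF.
  by rewrite powRM ?powR_ge0// -powRrM (mulrC r).
rewrite (@nneseries_finsupp _ n.*2); last 2 first.
- by move=> k; rewrite mulr_ge0// powR_ge0.
- by move=> k nk; rewrite fr [X in _ && X]ltnNge nk andbF.
under eq_bigr do rewrite fr.
rewrite powR1 lee_fin (block_sum n (fun k => ((maxn 1 k)%:R `^ mu * c) `^ r)).
apply: (@le_trans _ _ (\sum_(k < n) (n%:R)^-1)); last first.
  by rewrite sumr_const card_ord -(mulr_natr n%:R^-1 n) mulVf// gt_eqF.
apply: ler_sum => k _.
have kn : (n + k < n.*2)%N by rewrite -addnn ltn_add2l.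
apply: (@le_trans _ _ ((n%:R `^ (- invexp r%:E)) `^ r)).
  by rewrite ge0_ler_powR ?nnegrE ?mulr_ge0 ?powR_ge0 ?(ltW r0)// mle.
by rewrite invexp_fin// -powRrM mulNr mulVf ?gt_eqF// powR_inv1.
Qed.

End Class.
End SequenceEstimates.

(** * Upper bounds *)

Section PowerSums.
Context {R : realType}.
Implicit Types (k n N M : nat).

(** A mean value estimate covering concave and convex powers at once, by e^y >= 1 + y in
    [powR_succ_ge] and x + 1 <= 2 x. With it, sums of powers telescope and need no comparison with
    integrals. *)
Lemma powR_succ_sub (a x : R) : 0 <= a -> 1 <= x ->
  a / 2 * x `^ (a - 1) <= (x + 1) `^ a - x `^ a.
Proof.
move=> a0 x1; have x0 : 0 < x by exact: lt_le_trans x1.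
rewrite lerBrDr; apply: le_trans (powR_succ_ge a0 x0).
apply: (@le_trans _ _ (x `^ a * (1 + a / (x + 1)))); last first.
  by rewrite ler_wpM2l ?powR_ge0// expR_ge1Dx.
have -> : x `^ (a - 1) = x `^ a / x.
  by rewrite powRB ?(gt_eqF x0) ?implybT// powRr1// ltW.
rewrite mulrDr mulr1 addrC lerD2l (_ : a / 2 * _ = x `^ a * (a / (x * 2))).
  rewrite ler_wpM2l ?powR_ge0// ler_wpM2l// lef_pV2 ?posrE; first lra.
    by rewrite mulr_gt0.
  by rewrite addr_gt0.
by field; rewrite gt_eqF.
Qed.

Lemma sum_powR_head (a : R) N : 0 < a ->
  \sum_(0 <= k < N) k.+1%:R `^ (a - 1) <= 2 / a * N.+1%:R `^ a.
Proof.
move=> a0; elim: N => [|N IH].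
  by rewrite big_geq// mulr_ge0 ?powR_ge0// divr_ge0// ltW.
rewrite big_nat_recr//=; apply: (le_trans (lerD IH (lexx _))).
rewrite -lerBrDl -mulrBr.
have := @powR_succ_sub a N.+1%:R (ltW a0); rewrite ler1n natr1 => /(_ isT) h.
apply: (@le_trans _ _ (2 / a * (a / 2 * N.+1%:R `^ (a - 1)))).
  by apply: eq_ler; field; rewrite gt_eqF.
by rewrite ler_wpM2l// divr_ge0// ltW.
Qed.

(** [powR_succ_sub] applied to the difference of reciprocals; replacing (k + 1)^g by 2^g k^g in the
    denominator turns its factor 2 into 2^(g + 1). *)
Lemma powR_tail_step (g : R) k : 0 < g -> (0 < k)%N ->
  k%:R `^ (- 1 - g) <= 2 `^ (g + 1) / g * (k%:R `^ (- g) - k.+1%:R `^ (- g)).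
Proof.
move=> g0 k0; have x0 : 0 < k%:R :> R by rewrite ltr0n.
have x1 : 1 <= k%:R :> R by rewrite ler1n.
have -> : k.+1%:R = k%:R + 1 :> R by rewrite natr1.
set x := k%:R in x0 x1 *; clearbody x.
have y0 : 0 < x + 1 by rewrite addr_gt0.
have h := powR_succ_sub (ltW g0) x1.
have xg : 0 < x `^ g by rewrite powR_gt0.
have yg : 0 < (x + 1) `^ g by rewrite powR_gt0.
have y2 : (x + 1) `^ g <= 2 `^ g * x `^ g.
  rewrite -powRM ?(ltW x0)// ge0_ler_powR ?nnegrE ?(ltW g0) ?(ltW y0)//.
    by rewrite mulr_ge0// ltW.
  by lra.
rewrite !powRN (_ : (x `^ g)^-1 - _ =
  ((x + 1) `^ g - x `^ g) / (x `^ g * (x + 1) `^ g)); last first.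
  by field; rewrite !gt_eqF.
apply: (@le_trans _ _ (2 `^ (g + 1) / g * (g / 2 * x `^ (g - 1) / (x `^ g * (2 `^ g * x `^ g))))).
  apply: eq_ler; have -> : x `^ (-1 - g) = (x * x `^ g)^-1.
    rewrite -[X in X * _](powRr1 (ltW x0)) -powRD ?(gt_eqF x0) ?implybT//.
    by rewrite -powRN; congr (_ `^ _); ring.
  have -> : x `^ (g - 1) = x `^ g / x.
    by rewrite powRB ?(gt_eqF x0) ?implybT// powRr1// ltW.
  have -> : (2 : R) `^ (g + 1) = 2 `^ g * 2.
    by rewrite powRD ?powRr1 ?implybT// pnatr_eq0 implybT.
  by field; rewrite !gt_eqF// powR_gt0.
rewrite ler_wpM2l ?divr_ge0 ?powR_ge0 ?(ltW g0)//.
rewrite ler_pM ?invr_ge0 ?mulr_ge0 ?powR_ge0 ?(ltW g0)//.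
rewrite lef_pV2 ?posrE ?mulr_gt0 ?powR_gt0//.
by rewrite ler_wpM2l// ltW.
Qed.

Lemma sum_powR_tail (g : R) n M : 0 < g -> (0 < n)%N ->
  \sum_(n <= k < M) k%:R `^ (- 1 - g) <= 2 `^ (g + 1) / g * n%:R `^ (- g).
Proof.
move=> g0 n0; have T0 : 0 <= 2 `^ (g + 1) / g.
  by rewrite divr_ge0 ?powR_ge0// ltW.
have [Mn|nM] := leqP M n.
  by rewrite big_geq// mulr_ge0// powR_ge0.
suff : \sum_(n <= k < M) k%:R `^ (- 1 - g) + 2 `^ (g + 1) / g * M%:R `^ (- g) <=
    2 `^ (g + 1) / g * n%:R `^ (- g).
  by apply: le_trans; rewrite lerDl mulr_ge0// powR_ge0.
elim: M nM => // M IH; rewrite ltnS leq_eqVlt => /predU1P[<-|nM].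
  rewrite big_nat1; have := powR_tail_step g0 n0; rewrite mulrBr; lra.
rewrite big_nat_recr ?(ltnW nM)//=.
have := powR_tail_step g0 (leq_trans n0 (ltnW nM)); rewrite mulrBr.
by have := IH nM; lra.
Qed.

End PowerSums.

(** * Error of truncated multiplier methods *)

Section UpperBound.
Context {R : realType} (alpha mu : R) (s : \bar R).
Hypotheses (alpha0 : 0 <= alpha) (s1 : (1 <= s)%E) (smu : 1 - invexp s < mu).
Let gam : R := mu + invexp s - 1.
Let gam0 : 0 < gam.
Proof. by rewrite /gam; move: smu; lra. Qed.

Let tailC : R := 2 `^ (gam + 1) / gam + 1.
Let tailC0 : 0 <= tailC.
Proof. by rewrite addr_ge0// divr_ge0 ?powR_ge0// ltW. Qed.

(** In [Wclass_decomp] the first term is a power tail; in the second, k^(-gam) <= n^(-gam) leaves a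
    sum of at most 1. *)
Lemma Wclass_tail f n M : Wclass alpha mu s f -> (0 < n)%N ->
  \sum_(n <= k < M) `|coef alpha f k| <= tailC * n%:R `^ (- gam).
Proof.
move=> /(Wclass_decomp s1)[b [b0 b1 fb]] n0.
apply: (@le_trans _ _ (\sum_(n <= k < M) (k%:R `^ (- 1 - gam) + n%:R `^ (- gam) * b k))).
  apply: ler_sum_nat => k /andP[nk _]; apply: (le_trans (fb k)).
  have k0 : (0 < k)%N by exact: leq_trans nk.
  rewrite (maxn_idPr k0) lerD2l ler_wpM2r// !powRN lef_pV2 ?posrE ?powR_gt0 ?ltr0n//.
  by rewrite ge0_ler_powR ?nnegrE ?(ltW gam0)// ler_nat.
rewrite big_split /= /tailC mulrDl mul1r lerD ?sum_powR_tail//.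
rewrite -mulr_sumr ler_piMr ?powR_ge0//.
apply: le_trans (b1 M); rewrite -(big_mkord xpredT).
have [Mn|nM] := leqP M n; first by rewrite [leLHS]big_geq//; apply: sumr_ge0.
by rewrite (@big_cat_nat _ _ _ n 0 M)//= ?(ltnW nM)// lerDr; apply: sumr_ge0.
Qed.

(** As theta > gam, the weights (k / N)^theta let the indices near N dominate, so the bias has the
    order of the tail. The index 0 drops out through 0^theta = 0. *)
Lemma Wclass_head f n N (theta : R) : Wclass alpha mu s f -> (0 < N)%N ->
  (n <= N.+1)%N -> gam < theta ->
  \sum_(k < n) (k%:R / N%:R) `^ theta * `|coef alpha f k| <=
  (2 / (theta - gam) * 2 `^ (theta - gam) + 1) * N%:R `^ (- gam).
Proof.
move=> /(Wclass_decomp s1)[b [b0 b1 fb]] N0 nN gt.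
have th0 : 0 < theta by exact: lt_trans gt.
have tg0 : 0 < theta - gam by rewrite subr_gt0.
have N_gt0 : 0 < N%:R :> R by rewrite ltr0n.
pose F k : R := k%:R `^ (theta - gam - 1) + N%:R `^ (theta - gam) * b k.
have F0 k : 0 <= F k by rewrite addr_ge0 ?mulr_ge0 ?powR_ge0.
have term k : (k < n)%N -> (k%:R / N%:R) `^ theta * `|coef alpha f k| <=
    N%:R `^ (- theta) * (if k is 0 then 0 else F k).
  case: k => [|k] kn; first by rewrite mul0r powR0 ?mul0r ?mulr0// gt_eqF.
  rewrite powRM ?invr_ge0 ?ler0n// -powR_inv1 ?ler0n// -powRrM mulN1r.
  rewrite (mulrC (k.+1%:R `^ theta)) -mulrA ler_wpM2l ?powR_ge0//.
  have k0 : 0 < k.+1%:R :> R by [].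
  apply: (le_trans (ler_wpM2l (powR_ge0 _ _) (fb k.+1))).
  rewrite (maxn_idPr _)// mulrDr mulrA -!powRD ?(gt_eqF k0) ?implybT//.
  rewrite /F lerD//.
    by apply: eq_ler; congr (_ `^ _); rewrite /gam; ring.
  rewrite ler_wpM2r// ge0_ler_powR ?nnegrE ?(ltW tg0)//.
  by rewrite ler_nat -ltnS (leq_trans kn).
apply: (@le_trans _ _ (N%:R `^ (- theta) * \sum_(0 <= k < N) F k.+1)).
  apply: (@le_trans _ _ (\sum_(k < n) N%:R `^ (- theta) *
      (if k : nat is 0 then 0 else F k))).
    by apply: ler_sum => k _; exact: term.
  rewrite -mulr_sumr ler_wpM2l ?powR_ge0//.
  rewrite -(big_mkord xpredT (fun k => if k is 0 then 0 else F k)).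
  case: n nN {term} => [|n] nN; first by rewrite big_geq//; apply: sumr_ge0.
  rewrite big_nat_recl//= add0r.
  rewrite (@big_cat_nat _ _ _ n 0 N)//= lerDl; apply: sumr_ge0 => *; exact: F0.
have -> : N%:R `^ (- gam) = N%:R `^ (- theta) * N%:R `^ (theta - gam) :> R.
  by rewrite -powRD ?(gt_eqF N_gt0) ?implybT//; congr (_ `^ _); ring.
rewrite mulrCA ler_wpM2l ?powR_ge0// /F big_split /= mulrDl mul1r lerD//.
  apply: (le_trans (sum_powR_head _ tg0)).
  rewrite -(mulrA (2 / (theta - gam))) ler_wpM2l ?divr_ge0 ?(ltW tg0)//.
  rewrite -powRM ?ler0n// ge0_ler_powR ?nnegrE ?mulr_ge0 ?(ltW tg0)//.
  by rewrite -natrM ler_nat mul2n -addnn -addn1 leq_add2l.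
rewrite -mulr_sumr ler_piMr ?powR_ge0//.
apply: le_trans (b1 N.+1); rewrite -(big_mkord xpredT b) big_nat_recl//= lerDr//.
Qed.

(** [fsqrtw] is a limit, so convergence comes first: it is absolute, by the bound on the l_k and the
    summable coefficients. Bounds on partial sums then pass to the limit. *)
Lemma fsqrtw_near f t n (A B : R) (Cl : R) : 0 <= Cl -> Wclass alpha mu s f ->
  (0 < n)%N ->
  (forall k, `|nlaguerre alpha k t * Num.sqrt (weight alpha t)| <= Cl) ->
  (forall M, (n <= M)%N -> `|\sum_(k < M) coef alpha f k * nlaguerre alpha k t *
      Num.sqrt (weight alpha t) - A| <= B) ->
  `|fsqrtw alpha f t - A| <= B.
Proof.
move=> Cl0 Wf n0 lC AB.
set u := fun k => coef alpha f k * nlaguerre alpha k t * Num.sqrt (weight alpha t).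
have cu : cvgn (series u).
  apply: normed_cvg; apply: nondecreasing_is_cvgn.
    by apply: nondecreasing_series => k _ _; exact: normr_ge0.
  (* Index 0 is set apart because the tail estimate starts at 1. *)
  exists (Cl * (\sum_(0 <= k < 1) `|coef alpha f k| + tailC * 1%:R `^ (- gam))).
  move=> _ [M _ <-]; rewrite /series /=.
  apply: (@le_trans _ _ (\sum_(0 <= k < M) Cl * `|coef alpha f k|)).
    apply: ler_sum => k _; rewrite /u -mulrA normrM mulrC.
    by rewrite ler_wpM2r.
  rewrite -mulr_sumr ler_wpM2l//.
  apply: le_trans (lerD (lexx _) (@Wclass_tail f 1 M Wf isT)).
  case: M => [|M]; first by rewrite [leLHS]big_geq//; apply: addr_ge0; apply: sumr_ge0.
  by rewrite (@big_cat_nat _ _ _ 1 0 M.+1).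
have AB' : \forall M \near \oo, `|series u M - A| <= B.
  by exists n => // M nM; rewrite /series /= big_mkord; exact: AB.
rewrite ler_norml /fsqrtw -/u; apply/andP; split; [rewrite lerBrDl|rewrite lerBlDl].
  by apply: limr_ge => //; apply: filterS AB' => M; rewrite ler_norml lerBrDl => /andP[].
by apply: limr_le => //; apply: filterS AB' => M; rewrite ler_norml lerBlDl => /andP[].
Qed.

(** For k < n the k-th term is l_k times (1 - nu_k) f_k - nu_k x_k, with x the noise. The case n = N
    is recovery from N coefficients, n = N + 1 is S_N, which includes degree N. Allowing both costs
    n <= 2 N, so that the noise constant is 4 = 2 * 2. *)
Lemma truncation_error : exists2 Cl : R, 0 < Cl &
  forall (f fd : R -> R) (p : \bar R) (delta theta Cnu t : R) (n N : nat)
    (nu : nat -> R),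
  Wclass alpha mu s f -> (1 <= p)%E -> 0 < delta -> 0 < t ->
  (0 < N)%N -> (N <= n <= N.+1)%N -> gam < theta -> 0 <= Cnu ->
  (lpnorm p (fun k => coef alpha fd k - coef alpha f k)%R <= delta%:E)%E ->
  (forall k, (k < n)%N -> `|1 - nu k| <= Cnu * (k%:R / N%:R) `^ theta) ->
  `|fsqrtw alpha f t - (\sum_(0 <= k < n) nu k * coef alpha fd k *
      nlaguerre alpha k t) * Num.sqrt (weight alpha t)| <=
  Cl * ((tailC + Cnu * (2 / (theta - gam) * 2 `^ (theta - gam) + 1)) * N%:R `^ (- gam)
    + 4 * (1 + Cnu) * (delta * N%:R `^ (1 - invexp p))).
Proof.
have [Cl Cl0 lC] := nlaguerre_bounded alpha0.
exists Cl => // f fd p delta theta Cnu t n N nu Wf p1 d0 t0 N0 /andP[Nn nN] gt C0 fdf nuC.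
have N_gt0 : 0 < N%:R :> R by rewrite ltr0n.
have n0 : (0 < n)%N by exact: leq_trans Nn.
set l := fun k => nlaguerre alpha k t * Num.sqrt (weight alpha t).
apply: (@fsqrtw_near f t n _ _ Cl (ltW Cl0) Wf n0 (fun k => lC k t t0)) => M nM.
pose u k := coef alpha f k * nlaguerre alpha k t * Num.sqrt (weight alpha t).
rewrite big_mkord mulr_suml -(big_mkord xpredT u).
rewrite (@big_cat_nat _ _ _ n 0 M)//= big_mkord addrAC -sumrB.
apply: (le_trans (ler_normD _ _)).
pose x k := coef alpha fd k - coef alpha f k.
have h1 : `|\sum_(n <= k < M) coef alpha f k * nlaguerre alpha k t *
    Num.sqrt (weight alpha t)| <= Cl * (tailC * N%:R `^ (- gam)).
  apply: (le_trans (ler_norm_sum _ _ _)).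
  apply: (@le_trans _ _ (\sum_(n <= k < M) Cl * `|coef alpha f k|)).
    apply: ler_sum => k _; rewrite -mulrA normrM mulrC ler_wpM2r//.
    exact: lC.
  rewrite -mulr_sumr ler_wpM2l ?(ltW Cl0)//.
  apply: (le_trans (Wclass_tail M Wf n0)); rewrite ler_wpM2l// !powRN.
  rewrite lef_pV2 ?posrE ?powR_gt0 ?ltr0n//.
  by rewrite ge0_ler_powR ?nnegrE ?(ltW gam0)// ler_nat.
have nu1 k : (k < n)%N -> `|nu k| <= 1 + Cnu.
  move=> kn; rewrite (_ : nu k = 1 - (1 - nu k)); last by ring.
  apply: (le_trans (ler_normB _ _)); rewrite normr1 lerD2l.
  apply: (le_trans (nuC k kn)); rewrite ler_piMr//.
  apply: (@le_trans _ _ (1 `^ theta)); last by rewrite powR1.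
  rewrite ge0_ler_powR ?nnegrE ?divr_ge0//.
    by rewrite ltW// (lt_trans gam0).
  by rewrite ler_pdivrMr// mul1r ler_nat -ltnS (leq_trans kn).
have h2 : `|\sum_(i < n) (coef alpha f i * nlaguerre alpha i t * Num.sqrt (weight alpha t)
     - nu i * coef alpha fd i * nlaguerre alpha i t * Num.sqrt (weight alpha t))| <=
   Cl * (\sum_(k < n) `|1 - nu k| * `|coef alpha f k| + (1 + Cnu) * \sum_(k < n) `|x k|).
  apply: (le_trans (ler_norm_sum _ _ _)).
  rewrite (mulr_sumr _ _ _ (1 + Cnu)) -big_split /= mulr_sumr; apply: ler_sum => k _.
  rewrite (_ : _ - _ = l k * ((1 - nu k) * coef alpha f k - nu k * x k)); last first.
    by rewrite /l /x; ring.
  rewrite normrM ler_pM//; first exact: lC.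
  apply: (le_trans (ler_normB _ _)); rewrite !normrM lerD2l ler_wpM2r//.
  exact: nu1.
have h3 : \sum_(k < n) `|1 - nu k| * `|coef alpha f k| <=
    Cnu * ((2 / (theta - gam) * 2 `^ (theta - gam) + 1) * N%:R `^ (- gam)).
  apply: (@le_trans _ _ (Cnu * \sum_(k < n) (k%:R / N%:R) `^ theta * `|coef alpha f k|)).
    rewrite mulr_sumr; apply: ler_sum => k _.
    by rewrite mulrA ler_wpM2r// nuC.
  by rewrite ler_wpM2l// Wclass_head.
have ip : 0 <= 1 - invexp p.
  case: p p1 {fdf} => [r|_|//]; last by rewrite invexp_oo subr0.
  rewrite lee_fin => r1; rewrite invexp_fin// subr_ge0 invf_le1//.
  exact: lt_le_trans r1.
have ip1 : 1 - invexp p <= 1.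
  case: p p1 {fdf ip} => [r|_|//]; last by rewrite invexp_oo subr0.
  rewrite lee_fin => r1; rewrite invexp_fin// gerBl invr_ge0.
  exact: le_trans r1.
have h4 : \sum_(k < n) `|x k| <= 4 * (delta * N%:R `^ (1 - invexp p)).
  apply: (le_trans (lpnorm_sum_le p1 d0 n0 fdf)).
  have : n%:R `^ (1 - invexp p) <= 2 * N%:R `^ (1 - invexp p).
    apply: (@le_trans _ _ ((2 * N%:R) `^ (1 - invexp p))).
      rewrite ge0_ler_powR ?nnegrE ?mulr_ge0// -natrM ler_nat mul2n -addnn.
      by rewrite (leq_trans nN)// -addn1 leq_add2l.
    rewrite powRM ?ler0n// ler_wpM2r ?powR_ge0//.
    by rewrite -[leRHS]powRr1// ler_powR// ler1n.
  move=> /(ler_wpM2l (ltW d0)); lra.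
set T := 2 / (theta - gam) * 2 `^ (theta - gam) + 1 in h3 *.
apply: (le_trans (lerD h2 h1)).
rewrite -mulrDr ler_wpM2l ?(ltW Cl0)//.
have := ler_wpM2l (addr_ge0 ler01 C0) h4.
move: h3; lra.
Qed.

End UpperBound.

(** * Lower bounds *)

Section LowerBound.
Context {R : realType} (alpha : R).
Hypothesis alpha0 : 0 <= alpha.

(* Near t = 1/(8n) the polynomials of degree in [n, 2n) are still comparable to
   their value at 0. *)
Lemma nlaguerre_lower : exists2 c : R, 0 < c & forall n k, (0 < n)%N ->
  (n <= k < n.*2)%N ->
  c <= nlaguerre alpha k (8 * n%:R)^-1 * Num.sqrt (weight alpha (8 * n%:R)^-1).
Proof.
have G0 : 0 < Gamma (alpha + 1) by rewrite Gamma_gt0// lerDr.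
have g0 k : 0 < gamma_ratio alpha k by exact: gamma_ratio_gt0.
(* The 4 comes from L_k(t) >= L_k(0) / 2, 8^alpha from the weight at 1/(8n), e^(-1) from e^(-t), and
   (1 + alpha)^alpha from [gamma_ratio_ge]; the powers n^alpha cancel. *)
pose C : R := gamma_ratio alpha 0 * expR (- 1) /
  ((1 + alpha) `^ alpha * 8 `^ alpha * (4 * Gamma (alpha + 1) ^+ 2)).
have a1 : 0 < 1 + alpha by rewrite ltr_wpDr.
have C0 : 0 < C.
  apply: divr_gt0; first by apply: mulr_gt0; [exact: g0|exact: expR_gt0].
  by do 2!apply: mulr_gt0; rewrite ?powR_gt0 ?mulr_gt0 ?exprn_gt0.
exists (Num.sqrt C); first by rewrite sqrtr_gt0.
move=> n k n0 /andP[nk k2n]; set t := (8 * n%:R)^-1.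
have n_gt0 : 0 < n%:R :> R by rewrite ltr0n.
have t0 : 0 < t by rewrite invr_gt0 mulr_gt0.
have kt : k%:R * t <= 4^-1.
  have : k%:R <= 2 * n%:R :> R by rewrite -natrM ler_nat mul2n ltnW.
  move=> /(ler_wpM2r (ltW t0)) /le_trans; apply; apply: eq_ler; rewrite /t; field.
  by rewrite gt_eqF.
have t1 : t <= 1.
  rewrite invf_le1 ?mulr_gt0//; have : 1 <= n%:R :> R by rewrite ler1n.
  lra.
have Pt := laguerrep_ge alpha0 (ltW t0) kt.
have p0E : (laguerrep alpha k)`_0 = gamma_ratio alpha k / Gamma (alpha + 1).
  rewrite coef0_laguerrep gamma_ratioE; field.
  by rewrite (gt_eqF G0) pnatr_eq0 -lt0n fact_gt0.
have w0 : 0 <= weight alpha t by rewrite mulr_ge0 ?powR_ge0 ?expR_ge0.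
have p00 := coef0_laguerrep_gt0 k alpha0.
have nl0 : 0 <= nlaguerre alpha k t.
  by rewrite nlaguerreE mulr_ge0 ?sqrtr_ge0// (le_trans _ Pt)// divr_ge0// ltW.
rewrite -(@ler_pXn2r _ 2)// ?nnegrE ?sqrtr_ge0//; last by rewrite mulr_ge0 ?sqrtr_ge0.
rewrite sqr_sqrtr ?(ltW C0)// exprMn (sqr_sqrtr w0) nlaguerreE exprMn.
rewrite sqr_sqrtr ?invr_ge0 ?(ltW (g0 k))//.
apply: (@le_trans _ _ ((gamma_ratio alpha k)^-1 *
   ((laguerrep alpha k)`_0 / 2) ^+ 2 * weight alpha t)); last first.
  rewrite ler_wpM2r// ler_wpM2l ?invr_ge0 ?(ltW (g0 k))//.
  by rewrite lerXn2r// nnegrE ?(le_trans _ Pt)// divr_ge0// ltW.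
rewrite p0E (_ : _ * _ * _ = gamma_ratio alpha k * weight alpha t /
  (4 * Gamma (alpha + 1) ^+ 2)); last first.
  by field; rewrite (gt_eqF G0) gt_eqF.
have G4 : 0 <= (4 * Gamma (alpha + 1) ^+ 2)^-1.
  by rewrite invr_ge0 mulr_ge0 ?sqr_ge0.
rewrite /C invfM mulrA ler_wpM2r//.
have gk : gamma_ratio alpha 0 * n%:R `^ alpha <= gamma_ratio alpha k * (1 + alpha) `^ alpha.
  apply: le_trans (gamma_ratio_ge alpha0 k); rewrite ler_wpM2l ?(ltW (g0 0%N))//.
  have nk' : n%:R <= k%:R :> R by rewrite ler_nat.
  rewrite ge0_ler_powR ?nnegrE//; last by lra.
  by rewrite addr_ge0// addr_ge0.
rewrite ler_pdivrMr ?mulr_gt0 ?powR_gt0//.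
have -> : weight alpha t = expR (- t) / (8 `^ alpha * n%:R `^ alpha).
  rewrite /weight /t -powR_inv1 ?mulr_ge0// -powRrM mulN1r powRN powRM//.
  by rewrite mulrC.
have e1 : expR (- 1) <= expR (- t) by rewrite ler_expR lerN2.
have N0 : 0 < n%:R `^ alpha by rewrite powR_gt0.
have E0 : 0 < (8 : R) `^ alpha by rewrite powR_gt0.
rewrite (_ : gamma_ratio alpha k * _ * _ = gamma_ratio alpha k * (1 + alpha) `^ alpha
  * expR (- t) / n%:R `^ alpha); last by field; rewrite !gt_eqF.
rewrite ler_pdivlMr// mulrAC; apply: ler_pM => //.
by apply: mulr_ge0; [exact/ltW/g0|exact: ltW].
Qed.

Variables (mu : R) (s : \bar R).
Hypotheses (s1 : (1 <= s)%E) (mu0 : 0 < mu) (smu : 1 - invexp s < mu).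
Let gam : R := mu + invexp s - 1.
Let gam0 : 0 < gam.
Proof. by rewrite /gam; move: smu; lra. Qed.

Lemma invexp_ge0_le1 (p : \bar R) : (1 <= p)%E -> 0 <= invexp p <= 1.
Proof.
case: p => [r|_|//]; last by rewrite invexp_oo lexx ler01.
rewrite lee_fin => r1; have r0 : 0 < r by exact: lt_le_trans r1.
by rewrite invexp_fin// invr_ge0 ltW//= invf_le1.
Qed.

Lemma rateE p : rate mu s p = gam / (gam + 1 - invexp p).
Proof. by rewrite /rate /gam; congr (_ / _); ring. Qed.

(** Since delta < 1, the scale is at least 1, so floor plus one at most doubles it. *)
Lemma exists_scale (delta D : R) : 0 < delta -> delta < 1 -> 0 < D ->
  exists2 N : nat, (0 < N)%N &
    1 * delta `^ (- (1 / D)) <= N%:R <= 2 * delta `^ (- (1 / D)).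
Proof.
move=> d0 d1 D0; set S := delta `^ _.
have S1 : 1 <= S.
  rewrite /S powRN mul1r -powR_inv1 ?powR_ge0// -powRrM mulrN1 -(powRr0 delta).
  by rewrite ger_powR ?d0 ?(ltW d1)// oppr_le0 invr_ge0 ltW.
exists (Num.truncn S).+1 => //; rewrite mul1r; apply/andP; split.
  by rewrite ltW// truncnS_gt.
have : (Num.truncn S)%:R <= S by rewrite truncn_le// (le_trans ler01).
by rewrite -natr1; lra.
Qed.

Lemma opt_err_ge : exists2 c : R, 0 < c &
  forall (p : \bar R) (delta : R), (1 <= p)%E -> 0 < delta -> delta < 1 ->
    ((c * delta `^ rate mu s p)%:E <= opt_err alpha mu s p delta)%E.
Proof.
have [c0 c00 lower] := nlaguerre_lower.
exists (c0 * 2 `^ (- mu) * 2 `^ (- gam)).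
  by rewrite !mulr_gt0 ?powR_gt0.
move=> p delta p1 d0 d1; have /andP[ip0 ip1] := invexp_ge0_le1 p1.
set D := gam + 1 - invexp p.
have D0 : 0 < D by rewrite /D; move: gam0 ip1; lra.
have [n n0 /andP[nS nS2]] := exists_scale d0 d1 D0.
have n_gt0 : 0 < n%:R :> R by rewrite ltr0n.
set S := delta `^ _ in nS nS2; rewrite mul1r in nS.
have S0 : 0 < S by rewrite powR_gt0.
(* This height keeps the block in the class, and its l_p norm is at most n^(-D) <= S^(-D) = delta
   because n >= S. *)
pose c1 : R := 2 `^ (- mu) * n%:R `^ (- mu - invexp s).
have c10 : 0 <= c1 by rewrite mulr_ge0 ?powR_ge0.
pose t : R := (8 * n%:R)^-1.
have t0 : 0 < t by rewrite invr_gt0 mulr_gt0.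
pose l k := nlaguerre alpha k t * Num.sqrt (weight alpha t).
pose F (e : R) : R -> R := horner (lagsum alpha n.*2 (block n (e * c1))).
pose V : R := c1 * \sum_(k < n) l (n + k)%N.
have coefF e k : coef alpha (F e) k = block n (e * c1) k.
  rewrite coef_lagsum// /block; case: ltnP => //; by rewrite andbF.
have coefFn e : `|e| = 1 -> forall k, `|coef alpha (F e) k| = block n c1 k.
  move=> e1 k; rewrite coefF /block; case: ifP => _; last by rewrite normr0.
  by rewrite normrM e1 mul1r ger0_norm.
have WF e : `|e| = 1 -> Wclass alpha mu s (F e).
  move=> e1; split; first exact: L2w_poly.
  exact: (wnorm_block s1 mu0 n0 (coefFn e e1)).
have FV e : `|e| = 1 -> fsqrtw alpha (F e) t = e * V.
  move=> e1; apply/eqP; rewrite -subr_eq0 -normr_le0.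
  have [Cl Cl0 lC] := nlaguerre_bounded alpha0.
  apply: (@fsqrtw_near R alpha mu s s1 smu (F e) t n.*2 _ _ Cl (ltW Cl0) (WF e e1)).
  - by rewrite double_gt0.
  - by move=> k; exact: lC.
  move=> M nM; rewrite normr_le0 subr_eq0; apply/eqP.
  rewrite -(big_mkord xpredT (fun k => coef alpha (F e) k * nlaguerre alpha k t *
    Num.sqrt (weight alpha t))) (@big_cat_nat _ _ _ n.*2)//= [X in _ + X]big1_seq.
    rewrite addr0 big_mkord /V mulrA mulr_sumr -(block_sum n (fun k => e * c1 * l k)).
    apply: eq_bigr => k _; rewrite coefF /block -mulrA; case: ifP => //.
    by rewrite mul0r.
  move=> k /=; rewrite mem_index_iota => /andP[nk _].
  by rewrite coefF /block [X in _ && X]ltnNge nk andbF !mul0r.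
(* V >= c1 n c0 is of order n^(-gam); n <= 2 S then yields the factor 2^(-gam). *)
have hV : c0 * 2 `^ (- mu) * 2 `^ (- gam) * delta `^ rate mu s p <= V.
  apply: (@le_trans _ _ (c1 * (n%:R * c0))); last first.
    rewrite ler_wpM2l// mulr_natl -[X in _ *+ X]card_ord -sumr_const.
    apply: ler_sum => k _; apply: lower => //.
    by rewrite leq_addr -addnn ltn_add2l ltn_ord.
  rewrite /c1 (_ : _ * _ * (n%:R * c0) = c0 * 2 `^ (- mu) *
    (n%:R `^ (- mu - invexp s) * n%:R `^ 1)); last by rewrite powRr1//; ring.
  rewrite -powRD ?(gt_eqF n_gt0) ?implybT// -mulrA ler_wpM2l ?mulr_ge0 ?powR_ge0 ?(ltW c00)//.
  rewrite (_ : - mu - invexp s + 1 = - gam); last by rewrite /gam; ring.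
  rewrite rateE -/D (_ : gam / D = (- (1 / D)) * (- gam)); last by field; rewrite gt_eqF.
  rewrite powRrM -/S -powRM ?(ltW S0)// !powRN lef_pV2 ?posrE ?powR_gt0 ?mulr_gt0//.
  by rewrite ge0_ler_powR ?nnegrE ?(ltW gam0) ?mulr_ge0 ?(ltW S0).
apply: le_ereal_inf_tmp => _ [A [psi _ AE] <-].
pose z := A (horner 0) t * Num.sqrt (weight alpha t).
have errF e : `|e| = 1 -> (`|e * V - z|%:E <= err alpha mu s p delta A)%E.
  move=> e1; apply: (@le_trans _ _ (normC (fun t =>
     fsqrtw alpha (F e) t - A (horner 0) t * Num.sqrt (weight alpha t)))).
    rewrite /z -(FV e e1); apply: ereal_sup_ubound; exists t => //.
    by rewrite /half_line /= in_itv /= andbT.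
  apply: ereal_sup_ubound; exists (F e), (horner 0); split => //.
  - exact: WF.
  - exact: L2w_poly.
  apply: (@lpnorm_block _ p _ n c1 delta) => //; first exact: ltW.
    by move=> k; rewrite coef_horner0// sub0r normrN coefFn.
  rewrite /c1 -mulrA -powRD ?(gt_eqF n_gt0) ?implybT//.
  rewrite (_ : - mu - invexp s + invexp p = - D); last by rewrite /D /gam; ring.
  apply: (@le_trans _ _ (S `^ (- D))); last first.
    rewrite /S -powRrM (_ : - (1 / D) * - D = 1) ?powRr1 ?(ltW d0)//.
    by field; rewrite gt_eqF.
  apply: (@le_trans _ _ (1 * n%:R `^ (- D))).
    rewrite ler_wpM2r ?powR_ge0// powRN invf_le1 ?powR_gt0//.
    have h2 : 1 <= (2 : R) by rewrite ler1n.
    by have := ler_powR h2 (ltW mu0); rewrite powRr0.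
  rewrite mul1r !powRN lef_pV2 ?posrE ?powR_gt0//.
  by rewrite ge0_ler_powR ?nnegrE ?(ltW D0) ?(ltW S0).
have V0 : 0 <= V.
  by apply: le_trans hV; rewrite !mulr_ge0 ?powR_ge0// ltW.
(* Both signs share the output z for data 0; the function of sign opposite to z is missed by at
   least V. *)
have [z0|z0] := leP 0 z.
  apply: le_trans (errF (-1) _); last by rewrite normrN1.
  rewrite lee_fin (le_trans hV)// mulN1r -opprD normrN ger0_norm ?addr_ge0//.
  by rewrite lerDl.
apply: le_trans (errF 1 (normr1 _)).
rewrite lee_fin (le_trans hV)// mul1r ger0_norm ?lerDl ?oppr_ge0 ?(ltW z0)//.
by rewrite addr_ge0// oppr_ge0 ltW.
Qed.

End LowerBound.

(** * Orders of the errors *)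

Section Rates.
Context {R : realType} (mu : R) (s : \bar R).
Hypotheses (smu : 1 - invexp s < mu).
Let gam : R := mu + invexp s - 1.
Let gam0 : 0 < gam.
Proof. by rewrite /gam; move: smu; lra. Qed.

(** With delta = S^(-D), delta S^(1 - 1/p) = S^(-gam), so noise and truncation balance. Bounding
    b^(1 - 1/p) by 1 + b frees the constant from p. *)
Lemma N_range_rate (p : \bar R) (a b delta : R) (N : nat) :
  (1 <= p)%E -> 0 < a -> a <= b -> 0 < delta -> (0 < N)%N ->
  N_range mu s p a b delta N ->
  [/\ N%:R `^ (- gam) <= a `^ (- gam) * delta `^ rate mu s p,
      b `^ (- gam) * delta `^ rate mu s p <= N%:R `^ (- gam) &
      delta * N%:R `^ (1 - invexp p) <= (1 + b) * delta `^ rate mu s p].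
Proof.
move=> p1 a0 ab d0 N0; rewrite /N_range /=.
have /andP[ip0 ip1] := invexp_ge0_le1 p1.
have -> : mu - invexp p + invexp s = gam + 1 - invexp p by rewrite /gam; ring.
set D := gam + 1 - invexp p.
have D0 : 0 < D by rewrite /D; move: gam0 ip1; lra.
set S := delta `^ _ => -[aS bS].
have S0 : 0 < S by rewrite powR_gt0.
have b0 : 0 < b by exact: lt_le_trans ab.
have N_gt0 : 0 < N%:R :> R by rewrite ltr0n.
have rateS : delta `^ rate mu s p = S `^ (- gam).
  rewrite rateE -/gam -/D /S -powRrM; congr (_ `^ _).
  by field; rewrite gt_eqF.
rewrite rateS -!powRM ?(ltW a0) ?(ltW b0) ?(ltW S0)// !(powRN _ gam).
split.
- rewrite lef_pV2 ?posrE ?powR_gt0 ?mulr_gt0//.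
  by rewrite ge0_ler_powR ?nnegrE ?(ltW gam0) ?mulr_ge0 ?(ltW a0) ?(ltW S0).
- rewrite lef_pV2 ?posrE ?powR_gt0 ?mulr_gt0//.
  by rewrite ge0_ler_powR ?nnegrE ?(ltW gam0) ?mulr_ge0 ?(ltW b0) ?(ltW S0).
have q0 : 0 <= 1 - invexp p by rewrite subr_ge0.
have bq : b `^ (1 - invexp p) <= 1 + b.
  have [b1|/ltW b1] := leP b 1.
    apply: (@le_trans _ _ (1 `^ (1 - invexp p))); last by rewrite powR1 lerDl ltW.
    by rewrite ge0_ler_powR ?nnegrE ?(ltW b0).
  apply: (@le_trans _ _ (b `^ 1)); last by rewrite powRr1 ?(ltW b0)// lerDr.
  by rewrite ler_powR// gerBl.
apply: (@le_trans _ _ (delta * (b * S) `^ (1 - invexp p))).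
  rewrite ler_wpM2l ?(ltW d0)// ge0_ler_powR ?nnegrE//.
  by rewrite mulr_ge0 ?(ltW b0) ?(ltW S0).
have dE : delta * S `^ (1 - invexp p) = (S `^ gam)^-1.
  rewrite -powRN -[X in X * _](powRr1 (ltW d0)) /S -!powRrM -powRD ?(gt_eqF d0) ?implybT//.
  by congr (_ `^ _); rewrite /D; field; rewrite gt_eqF.
rewrite powRM ?(ltW b0) ?(ltW S0)// mulrCA dE.
by rewrite ler_wpM2r// invr_ge0 powR_ge0.
Qed.

End Rates.

Section Errors.
Context {R : realType} (alpha mu : R) (s : \bar R).
Hypotheses (alpha0 : 0 <= alpha) (s1 : (1 <= s)%E) (smu : 1 - invexp s < mu).
Let gam : R := mu + invexp s - 1.
Let gam0 : 0 < gam.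
Proof. by rewrite /gam; move: smu; lra. Qed.

Lemma err_le (p : \bar R) (delta M : R) (A : (R -> R) -> (R -> R)) :
  (forall f fd t, Wclass alpha mu s f -> 
    (lpnorm p (fun k => coef alpha fd k - coef alpha f k)%R <= delta%:E)%E ->
    0 < t -> `|fsqrtw alpha f t - A fd t * Num.sqrt (weight alpha t)| <= M) ->
  (err alpha mu s p delta A <= M%:E)%E.
Proof.
move=> h; apply: ge_ereal_sup => _ [f [fd [Wf _ fdf ->]]].
apply: ge_ereal_sup => _ [t /half_line_gt0 t0 <-].
by rewrite lee_fin h.
Qed.

Lemma truncation_err (theta Cnu a b : R) : gam < theta -> 0 <= Cnu ->
  0 < a -> a <= b ->
  exists2 c : R, 0 < c & forall (nu : nat -> R) (p : \bar R) (delta : R) (n N : nat)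
    (A : (R -> R) -> (R -> R)),
  (1 <= p)%E -> 0 < delta -> (0 < N)%N -> N_range mu s p a b delta N ->
  (N <= n <= N.+1)%N ->
  (forall k, (k < n)%N -> `|1 - nu k| <= Cnu * (k%:R / N%:R) `^ theta) ->
  (forall fd t, A fd t =
    \sum_(0 <= k < n) nu k * coef alpha fd k * nlaguerre alpha k t) ->
  (err alpha mu s p delta A <= (c * delta `^ rate mu s p)%:E)%E.
Proof.
move=> gt C0 a0 ab; have [Cl Cl0 tr] := truncation_error alpha0 s1 smu.
rewrite -/gam in tr.
set K1 : R := 2 `^ (gam + 1) / gam + 1.
set K2 : R := 2 / (theta - gam) * 2 `^ (theta - gam) + 1.
have K10 : 0 <= K1 by rewrite addr_ge0// divr_ge0 ?powR_ge0// ltW.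
have K20 : 0 <= K2.
  by rewrite addr_ge0// mulr_ge0 ?powR_ge0// divr_ge0// subr_ge0 ltW.
have b0 : 0 < b by exact: lt_le_trans ab.
pose c := (K1 + Cnu * K2) * a `^ (- gam) + 4 * (1 + Cnu) * (1 + b).
have c0 : 0 < c.
  apply: ltr_wpDl.
    apply: mulr_ge0; last exact: powR_ge0.
    by apply: addr_ge0 => //; exact: mulr_ge0.
  by rewrite !mulr_gt0// ltr_wpDr// ltW.
exists (Cl * c); first exact: mulr_gt0.
move=> nu p delta n N A p1 d0 N0 rg nN nuC AE.
have [r1 _ r3] := N_range_rate smu p1 a0 ab d0 N0 rg.
apply: err_le => f fd t Wf fdf t0; rewrite AE.
apply: (le_trans (tr f fd p delta theta Cnu t n N nu Wf p1 d0 t0 N0 nN gt C0 fdf nuC)).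
rewrite -(mulrA Cl c) ler_wpM2l ?(ltW Cl0)// /c -/K1 -/K2 [leRHS]mulrDl lerD//.
  rewrite -[leRHS]mulrA ler_wpM2l//.
  by rewrite addr_ge0// mulr_ge0.
rewrite -[leRHS]mulrA ler_wpM2l// mulr_ge0// addr_ge0//.
Qed.

(** Restriction to Omega can be moved into the recovery map, since masking keeps a sequence in
    l_2. *)
Lemma opt_err_leN (p : \bar R) (N : nat) (delta : R) :
  (opt_err alpha mu s p delta <= opt_errN alpha mu s p N delta)%E.
Proof.
apply: ereal_inf_le_tmp => _ [A [psi [Om [rpsi _ AE]]] <-].
exists A => //; exists (fun x => psi (fun k => if k \in Om then x k else 0)).
  move=> x x2; apply: rpsi; move: x2; rewrite /ell2 /=.
  have h12 : 1 <= 2 :> R by rewrite ler1n.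
  rewrite !lpnorm_finE// => /lty_poweRy x2; apply: poweR_lty.
  apply: le_lt_trans (x2 _); last by rewrite invr_neq0.
  apply: lee_nneseries => [k _ _|k _]; first by rewrite lee_fin powR_ge0.
  case: ifP => // _; rewrite normr0 lee_fin powR0//; exact: powR_ge0.
by rewrite AE; apply/funext => f.
Qed.

Lemma opt_errN_le (a b : R) : 0 < a -> a <= b -> exists2 c : R, 0 < c &
  forall (p : \bar R) (delta : R) (N : nat),
  (1 <= p)%E -> 0 < delta -> (0 < N)%N -> N_range mu s p a b delta N ->
  (opt_errN alpha mu s p N delta <= (c * delta `^ rate mu s p)%:E)%E.
Proof.
move=> a0 ab.
(* Plain truncation has bias constant 0, so any exponent above [gam] serves. *)
have gt : gam < gam + 1 by rewrite ltrDl.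
have [c c0 hc] := truncation_err gt (lexx 0) a0 ab.
exists c => // p delta N p1 d0 N0 rg.
pose Omega : {fset nat} := [fset k in iota 0 N]%fset.
have inO k : (k \in Omega) = (k < N)%N by rewrite !inE mem_iota add0n.
pose psi (x : nat -> R) : R -> R := horner (lagsum alpha N x).
pose A := psi \o coef_on alpha Omega.
apply: (@le_trans _ _ (err alpha mu s p delta A)).
  apply: ereal_inf_lbound; exists A => //; exists psi, Omega; split => //.
    move=> x _; apply: continuous_subspaceT; exact: continuous_horner.
  rewrite card_fseq undup_id ?iota_uniq// size_iota//.
apply: (hc (fun=> 1) p delta N N A) => //; first by rewrite leqnn leqnSn.
  by move=> k kN; rewrite subrr normr0 mul0r.
move=> fd t; rewrite /A /psi /= lagsumE big_mkord; apply: eq_bigr => k _.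
by rewrite /coef_on inO ltn_ord mul1r.
Qed.

End Errors.

Theorem theorem4p7 (R : realType) (alpha : R) (s : \bar R) (mu : R) :
  0 <= alpha -> (1 <= s)%E -> 1 - invexp s < mu -> 0 < mu ->
  [/\
   (exists c1 c2 : R, [/\ 0 < c1, 0 < c2 &
      forall (p : \bar R) (delta : R),
        (1 <= p)%E -> 0 < delta -> delta < 1 ->
        asymp c1 c2 (opt_err alpha mu s p delta)
                    (delta `^ rate mu s p)%:E]),
   (forall a b : R, 0 < a -> a <= b ->
      exists c1 c2 c3 c4 : R, [/\ [/\ 0 < c1, 0 < c2, 0 < c3 & 0 < c4] &
      forall (p : \bar R) (delta : R) (N : nat),
        (1 <= p)%E -> 0 < delta -> delta < 1 -> (1 <= N)%N ->
        N_range mu s p a b delta N ->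
        asymp c1 c2 (opt_errN alpha mu s p N delta)
                    (delta `^ rate mu s p)%:E /\
        asymp c3 c4 (delta `^ rate mu s p)%:E
                    (N%:R `^ (- mu - invexp s + 1))%:E]) &
   (forall theta Cnu a b : R,
      mu + invexp s - 1 < theta -> 0 < theta -> 0 < Cnu -> 0 < a -> a <= b ->
      exists2 c : R, 0 < c &
      forall nu : nat -> nat -> R, in_S theta Cnu nu ->
      forall (p : \bar R) (delta : R) (N : nat),
        (1 <= p)%E -> 0 < delta -> delta < 1 -> (1 <= N)%N ->
        N_range mu s p a b delta N ->
        (err alpha mu s p delta (method alpha nu N)
           <= (c * delta `^ rate mu s p)%:E)%E)].
Proof.
move=> alpha0 s1 smu mu0.
have [c c0 lower] := opt_err_ge alpha0 s1 mu0 smu.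
have lowerE p delta (x : \bar R) : (1 <= p)%E -> 0 < delta -> delta < 1 ->
    (opt_err alpha mu s p delta <= x)%E ->
    ((delta `^ rate mu s p)%:E <= c^-1%:E * x)%E.
  move=> p1 d0 d1 xle; have := le_trans (lower p delta p1 d0 d1) xle.
  move=> /(lee_wpmul2l (_ : 0 <= c^-1%:E)%E); rewrite lee_fin invr_ge0 (ltW c0) => /(_ isT).
  by rewrite -EFinM mulrA mulVf ?gt_eqF// mul1r.
split.
- have h12 : 1 <= 2 :> R by rewrite ler1n.
  (* Full information is at least as good as N coefficients, with N from [exists_scale]; hence a = 1
     and b = 2. *)
  have [C C0 upper] := opt_errN_le alpha0 s1 smu ltr01 h12.
  exists C, c^-1; split; rewrite ?invr_gt0// => p delta p1 d0 d1; split; last first.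
    exact: lowerE.
  have gam0 : 0 < mu + invexp s - 1 by move: smu; lra.
  have /andP[_ ip1] := invexp_ge0_le1 p1.
  have D0 : 0 < mu - invexp p + invexp s by move: gam0 ip1; lra.
  have [N N0 /andP[rg1 rg2]] := exists_scale d0 d1 D0.
  apply: (@le_trans _ _ (opt_errN alpha mu s p N delta)).
    exact: opt_err_leN.
  by rewrite -EFinM; apply: upper.
- move=> a b a0 ab; have b0 := lt_le_trans a0 ab.
  have [C C0 upper] := opt_errN_le alpha0 s1 smu a0 ab.
  exists C, c^-1, (b `^ (mu + invexp s - 1)), (a `^ (- (mu + invexp s - 1))).
  split; first by split; rewrite ?invr_gt0 ?powR_gt0.
  move=> p delta N p1 d0 d1 N0 rg.
  have [r1 r2 _] := N_range_rate smu p1 a0 ab d0 N0 rg.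
  have -> : - mu - invexp s + 1 = - (mu + invexp s - 1) by ring.
  split; split.
  + by rewrite -EFinM; exact: upper.
  + by apply: lowerE => //; exact: opt_err_leN.
  + rewrite -EFinM lee_fin -ler_pdivrMl ?powR_gt0// -powRN.
    exact: r2.
  + by rewrite -EFinM lee_fin.
- move=> theta Cnu a b gt th0 C0 a0 ab.
  have [C Cp upper] := truncation_err alpha0 s1 smu gt (ltW C0) a0 ab.
  exists C => // nu nuS p delta N p1 d0 d1 N0 rg.
  apply: (upper (nu N) p delta N.+1 N) => //.
    by rewrite leqnSn leqnn.
  by move=> k kN; exact: nuS.
Qed.
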